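(* Let $F:\mathbb{C}\to\mathbb{C}$ be a function in the class $\mathfrak{D}_{1,-}$, and let $\mathbf{t}_F(u,v)=\int_{\mathbb{C}}F(w)\,u(w)\,\overline{v(w)}\,\omega(w)\,d\lambda(w)$ be the associated sesquilinear form. Suppose that $\mathbf{t}_F$ has finite rank on reproducing kernels, i.e. there exist an integer $N\ge 0$ and functions $f_1,\dots,f_N,g_1,\dots,g_N\in\mathcal{B}^\circ$ such that $$\mathbf{t}_F(\kappa_z,\kappa_{z'})=\sum_{j=1}^N(\kappa_z,g_j)\,(f_j,\kappa_{z'})\qquad\text{for all } z,z'\in\mathbb{C}.$$ Then $F=0$ almost everywhere with respect to Lebesgue measure on $\mathbb{C}$.
   Context: Let $\lambda$ be Lebesgue measure on $\mathbb{C}\cong\mathbb{R}^2$ and $\omega(z)=\pi^{-1}e^{-|z|^2}$. The class $\mathfrak{D}_{1,-}$ consists of the (Lebesgue measurable, locally integrable) functions $F:\mathbb{C}\to\mathbb{C}$ such that for every $a<\infty$ one has $|F(z)|=O\big(e^{|z|^2-a|z|}\big)$ as $|z|\to\infty$. $\mathcal{B}^\circ$ denotes the space of entire functions on $\mathbb{C}$ belonging to $\mathfrak{D}_{1,-}$. For $z\in\mathbb{C}$, the reproducing kernel $\kappa_z$ is the entire function $\kappa_z(w)=\kappa(w,z)=e^{w\overline{z}}$, $w\in\mathbb{C}$. For $f\in\mathcal{B}^\circ$ and an entire function $v$ of exponential growth (for example $v=\kappa_z$), the pairing is $(f,v)=\int_{\mathbb{C}}f(w)\,\overline{v(w)}\,\omega(w)\,d\lambda(w)$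 and $(v,f)=\overline{(f,v)}$; these integrals converge absolutely. Likewise, for $F\in\mathfrak{D}_{1,-}$ the integral defining $\mathbf{t}_F(u,v)$ converges absolutely when $u,v$ are reproducing kernels. An empty sum ($N=0$) is understood to be $0$. *)

(* Defs.v *)
From HB Require Import structures.
From mathcomp Require Import all_boot all_order all_algebra.
From mathcomp Require Import all_classical all_reals all_analysis.
From mathcomp Require Import complex.

Set Implicit Arguments.
Unset Strict Implicit.
Unset Printing Implicit Defensive.

Import Order.TTheory GRing.Theory Num.Theory.
Import numFieldNormedType.Exports.

Local Open Scope classical_set_scope.
Local Open Scope ring_scope.
Local Open Scope complex_scope.

Section fock.
Context {R : realType}.
Local Notation C := R[i].

(* The product measure only lives on the Borel sets of the plane; its completed
   extension is Lebesgue measure on the Lebesgue sigma-algebra, just as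
   completed_lebesgue_measure is on the line. *)
Local Notation leb2 := (lebesgue_measure \x lebesgue_measure)%E.

Definition lebesgue_plane : Type :=
  caratheodory_type
    ((leb2 : set (measurableTypeR R * measurableTypeR R) -> \bar R)^*)%mu.

HB.instance Definition _ := Measurable.on lebesgue_plane.

Definition lebesgue_measure2 : set lebesgue_plane -> \bar R :=
  @completed_measure_extension _ _ _ leb2.

HB.instance Definition _ := Measure.on lebesgue_measure2.

Definition C_of_R2 (p : R * R) : C := p.1 +i* p.2.

Local Notation absC := Normc.normc.

Definition integralC (G : C -> C) : C :=
  (\int[lebesgue_measure2]_p complex.Re (G (C_of_R2 p))) +i*
  (\int[lebesgue_measure2]_p complex.Im (G (C_of_R2 p))).

Definition expC (z : C) : C :=
  (expR (complex.Re z))%:C * (cos (complex.Im z) +i* sin (complex.Im z)).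

Definition omega (z : C) : R := pi^-1 * expR (- absC z ^+ 2).

Definition measurable_funC (F : C -> C) : Prop :=
  measurable_fun setT (fun p : lebesgue_plane => complex.Re (F (C_of_R2 p))) /\
  measurable_fun setT (fun p : lebesgue_plane => complex.Im (F (C_of_R2 p))).

Definition locally_integrableC (F : C -> C) : Prop :=
  measurable_funC F /\
  forall K : set (R * R), compact K ->
    (\int[lebesgue_measure2]_(p in K) (absC (F (C_of_R2 p)))%:E < +oo)%E.

Definition D1minus (F : C -> C) : Prop :=
  locally_integrableC F /\
  forall a : R, exists M r : R, forall z : C, r <= absC z ->
    absC (F z) <= M * expR (absC z ^+ 2 - a * absC z).

(* Over the field of scalars C, derivable in the direction 1 is complex
   differentiability. *)
Definition entire (f : C -> C) : Prop :=
  forall z : C, derivable (f : C^o -> C^o) z 1.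

Definition Bcirc (f : C -> C) : Prop := entire f /\ D1minus f.

Definition kappa (z w : C) : C := expC (w * z^*).

Definition pairing (f v : C -> C) : C :=
  integralC (fun w => f w * (v w)^* * (omega w)%:C).

Definition pairing_rev (v f : C -> C) : C := (pairing f v)^*.

Definition tform (F u v : C -> C) : C :=
  integralC (fun w => F w * u w * (v w)^* * (omega w)%:C).

Definition finite_rank_on_kernels (F : C -> C) : Prop :=
  exists (N : nat) (f g : 'I_N -> (C -> C)),
    (forall j, Bcirc (f j)) /\ (forall j, Bcirc (g j)) /\
    forall z z' : C,
      tform F (kappa z) (kappa z') =
      \sum_(j < N) pairing_rev (kappa z) (g j) * pairing (f j) (kappa z').

End fock.

(* Main.v *)
(* Write [G := F * omega]; since [F] is in the class D_{1,-}, [G] has exponential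
   moments of every order, so [H(a, b) := \int G(w) e^(w a + conj(w) b)] is entire
   in both variables, and [t_F(kappa_z, kappa_z') = H(conj(z), z')] has finite rank.
   Suppose [H <> 0] and let [M = [H(a_i, b_k)]] be an invertible minor of maximal
   size.  Maximality gives [H(a, b) = H(a, b_.) M^-1 H(a_., b)], hence
     [det [H(a_i + z, b_k - conj(z))] * det M
       = det [H(a_i + z, b_k)] * det [H(a_i, b_k - conj(z))]].
   The left-hand side is a determinant of Fourier transforms of L^1 functions and
   tends to 0 at infinity (Riemann-Lebesgue); up to conjugating its second factor
   the right-hand side is an entire function of [z], which therefore vanishes by
   the maximum principle, although its value at 0 has modulus [|det M|^2].
   So [H = 0]; in particular the Fourier transform of [G] vanishes and [G = 0]
   almost everywhere. *)
Require Import Defs.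
From HB Require Import structures.
From mathcomp Require Import all_boot all_order all_algebra.
From mathcomp Require Import all_classical all_reals all_analysis.
From mathcomp Require Import measurable_realfun perm.
From mathcomp Require Import complex.
From mathcomp Require Import ring lra.

Set Implicit Arguments.
Unset Strict Implicit.
Unset Printing Implicit Defensive.
Import Order.TTheory GRing.Theory Num.Theory.
Import numFieldNormedType.Exports.
Import HBSimple.

Local Open Scope classical_set_scope.
Local Open Scope ring_scope.
Local Open Scope complex_scope.
(* Inside ring operations [z^*] would be parsed as [Num.conj]. *)
Local Notation "z ^*" := (conjc z) : ring_scope.

(** * Minors of finite-rank kernels *)

Section finite_rank.
Context {K : fieldType} {X Y : Type} (H : X -> Y -> K).

(** Both inputs from Fourier analysis, injectivity and Riemann-Lebesgue, come from one closure
    principle: a linear, L^1-closed class of integrable functions that is stable under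
    multiplication by every wave [cos (s X + t Y + c)] is stable under multiplication by every
    measurable indicator. For functions with zero Fourier transform, the zero frequency then gives a
    zero integral over every measurable set; for functions whose transform decays, everything
    reduces to boxes, where the decay is an explicit integral. Neither an inversion formula nor
    density of smooth functions is involved. The obstacle is that waves reach only Borel sets,
    whereas [F] is Lebesgue measurable; the condition [borel_mod0] bridges the two. Analyticity
    serves only the maximum principle, so it is replaced by uniform polynomial approximation on
    discs. The polynomials are explicit: [(1 + u / N) ^+ N] takes the place of the exponential under
    the integral. *)

Definition gram m n (x : 'I_m -> X) (y : 'I_n -> Y) : 'M[K]_(m, n) :=
  \matrix_(i, j) H (x i) (y j).

Lemma gram_rank N (a : 'I_N -> X -> K) (b : 'I_N -> Y -> K) m n
    (x : 'I_m -> X) (y : 'I_n -> Y) :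
  (forall x y, H x y = \sum_j a j x * b j y) -> (\rank (gram x y) <= N)%N.
Proof.
move=> HE.
rewrite (_ : gram x y = (\matrix_(i, j) a j (x i)) *m (\matrix_(i, j) b i (y j))).
  exact: leq_trans (mxrankM_maxl _ _) (rank_leq_col _).
by apply/matrixP=> i j; rewrite !mxE HE; apply: eq_bigr => k _; rewrite !mxE.
Qed.

Lemma det_schur m (A : 'M[K]_m) (u : 'cV[K]_m) (v : 'rV[K]_m) (h : 'M[K]_1) :
  A \in unitmx ->
  \det (block_mx A u v h) = \det A * \det (h - v *m invmx A *m u).
Proof.
move=> uA.
have -> : block_mx A u v h =
    block_mx 1%:M 0 (v *m invmx A) 1%:M *m
    block_mx A u 0 (h - v *m invmx A *m u).
  rewrite mulmx_block !mul1mx !mul0mx !addr0 mulmxKV//.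
  by rewrite subrKC.
by rewrite det_mulmx det_lblock det_ublock !det1 !mul1r.
Qed.

(** Bordering a minor of maximal size by one row and one column gives a singular matrix. By
    [det_schur] the scalar Schur complement then vanishes, and this is one entry of the
    factorization. The points [x'] and [y'] stay arbitrary, so that they can be moved later. *)
Lemma maximal_minor N (a : 'I_N -> X -> K) (b : 'I_N -> Y -> K) x0 y0 :
  (forall x y, H x y = \sum_j a j x * b j y) -> H x0 y0 != 0 ->
  exists n (x : 'I_n.+1 -> X) (y : 'I_n.+1 -> Y),
    gram x y \in unitmx /\
    forall (x' : 'I_n.+1 -> X) (y' : 'I_n.+1 -> Y),
      gram x' y' = gram x' y *m invmx (gram x y) *m gram x y'.
Proof.
move=> HE H0.
pose P n := `[< exists (x : 'I_n -> X) (y : 'I_n -> Y),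
                 gram x y \in unitmx >].
have P1 : P 1%N.
  apply/asboolP; exists (fun=> x0), (fun=> y0).
  by rewrite unitmxE det_mx11 mxE unitfE.
have PN n : P n -> (n <= N)%N.
  move=> /asboolP[x [y u]]; rewrite -(mxrank_unit u).
  exact: gram_rank HE.
case: (@ex_maxnP P N (ex_intro (fun n => P n) 1%N P1) PN) => -[|n] Pn nmax.
  by have := nmax _ P1.
move/asboolP: Pn => [x [y u]]; exists n, x, y; split => // x' y'.
apply/matrixP => i k.
(* The size is written [n.+1 + 1] so that [fintype.split] matches the index split of [block_mx]. *)
have : gram (fun j : 'I_(n.+1 + 1) => match fintype.split j with
              inl j => x j | inr _ => x' i end)
            (fun j : 'I_(n.+1 + 1) => match fintype.split j with
              inl j => y j | inr _ => y' k end) \notin unitmx.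
  apply/negP => u'; have := nmax (n.+1 + 1)%N; rewrite addn1 ltnn.
  suff -> : P n.+2 by move=> /(_ erefl).
  rewrite -[n.+2]addn1.
  by apply/asboolP; eexists; eexists; exact: u'.
set B := gram _ _.
have -> : B = block_mx (gram x y) (\col_j H (x j) (y' k))
    (\row_j H (x' i) (y j)) (H (x' i) (y' k))%:M.
  apply/matrixP => j l; rewrite !mxE.
  case: (fintype.split j) => j'; rewrite !mxE;
    case: (fintype.split l) => l'; rewrite !mxE //.
  by rewrite !ord1.
rewrite unitmxE det_schur// unitrM -unitmxE u /= det_mx11 unitfE negbK.
rewrite !mxE subr_eq0 eqxx mulr1n => /eqP ->.
apply: eq_bigr => l _; rewrite !mxE; congr (_ * _).
by apply: eq_bigr => q _; rewrite !mxE.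
Qed.

End finite_rank.

(** * The maximum principle *)

Section poly_approx.
Context {R : realType}.
Local Notation C := R[i].
Local Notation absC := (@Normc.normc R).

Lemma absC_ge0 (z : C) : 0 <= absC z.
Proof. by case: z => a b; exact: sqrtr_ge0. Qed.

Lemma absCD (z w : C) : absC (z + w) <= absC z + absC w.
Proof. exact: le_normcD. Qed.

Lemma absCN (z : C) : absC (- z) = absC z. Proof. exact: normcN. Qed.

Lemma absCM (z w : C) : absC (z * w) = absC z * absC w.
Proof. exact: Normc.normcM. Qed.

Lemma absC_real (x : R) : absC x%:C = `|x|.
Proof. by rewrite /= expr0n addr0 sqrtr_sqr. Qed.

Lemma absCJ (z : C) : absC z^* = absC z.
Proof. by case: z => a b /=; rewrite sqrrN. Qed.

Lemma absC_X (z : C) n : absC (z ^+ n) = absC z ^+ n.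
Proof.
elim: n => [|n IH]; first by rewrite !expr0 Normc.normc1.
by rewrite !exprS absCM IH.
Qed.

Lemma absC_nat n : absC n%:R = n%:R.
Proof. by rewrite -(rmorph_nat (real_complex R)) absC_real normr_nat. Qed.

Lemma absC_Re (z : C) : `|complex.Re z| <= absC z.
Proof. by have := normc_ge_Re z; rewrite lecR. Qed.

Lemma absC_Im (z : C) : `|complex.Im z| <= absC z.
Proof.
by case: z => a b /=; rewrite -[`|b|]sqrtr_sqr ler_wsqrtr// lerDr sqr_ge0.
Qed.

Lemma absC_le (z : C) : absC z <= `|complex.Re z| + `|complex.Im z|.
Proof.
case: z => a b /=.
rewrite -(ger0_norm (addr_ge0 (normr_ge0 a) (normr_ge0 b))) -sqrtr_sqr.
rewrite ler_wsqrtr// sqrrD !real_normK ?num_real//.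
by have := mulr_ge0 (normr_ge0 a) (normr_ge0 b); lra.
Qed.

Lemma absC_sum (I : Type) (s : seq I) (f : I -> C) :
  absC (\sum_(i <- s) f i) <= \sum_(i <- s) absC (f i).
Proof.
elim: s => [|i s IH]; first by rewrite !big_nil Normc.normc0.
by rewrite !big_cons (le_trans (absCD _ _))// lerD2l.
Qed.

Lemma absC_prod (I : Type) (s : seq I) (f : I -> C) :
  absC (\prod_(i <- s) f i) = \prod_(i <- s) absC (f i).
Proof.
elim: s => [|i s IH]; first by rewrite !big_nil Normc.normc1.
by rewrite !big_cons absCM IH.
Qed.

(** One factor of each of the (n+1)! products supplies [e]; the others are at most 1 because
    [e <= 1]. *)
Lemma absC_det_le n (A : 'M[C]_n.+1) (e : R) : e <= 1 ->
  (forall i j, absC (A i j) <= e) -> absC (\det A) <= (n.+1)`!%:R * e.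
Proof.
move=> e1 Ae; have e0 : 0 <= e := le_trans (absC_ge0 _) (Ae ord0 ord0).
apply: le_trans (absC_sum _ _) _.
have h (s : 'S_n.+1) :
    absC ((-1) ^+ s * \prod_i A i (s i)) <= e.
  rewrite absCM absC_X absCN Normc.normc1 expr1n mul1r.
  rewrite absC_prod (bigD1 ord0)//= -[leRHS]mulr1 ler_pM ?absC_ge0//.
    by apply: prodr_ge0 => i _; exact: absC_ge0.
  by apply: prodr_ile1 => i _; rewrite absC_ge0/= (le_trans (Ae _ _)).
apply: le_trans (ler_sum _ (fun s _ => h s)) _.
by rewrite sumr_const card_Sn mulr_natl.
Qed.

(* Averaging over [z] and [-z] halves the degree and keeps the constant term,
   so no roots of unity are needed. *)
Lemma max_modulus_poly (p : {poly C}) (r B : R) : 0 <= r ->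
  (forall z, absC z = r -> absC p.[z] <= B) -> absC p.[0] <= B.
Proof.
have [n] := ubnP (size p); elim: n p r => // n IH p r.
rewrite ltnS => sp r0 pB.
have [sp1|sp1] := leqP (size p) 1.
  have /pB : absC r%:C = r by rewrite absC_real ger0_norm.
  by rewrite (size1_polyC sp1) !hornerC.
have pE : p.[0] = (even_poly p).[0].
  by rewrite !horner_coef0 coef_even_poly double0.
rewrite pE; apply: (IH _ (r ^+ 2)).
- apply: leq_trans sp; rewrite ltnNge; apply/negP => sp'.
  have := leq_trans sp' (size_even_poly p).
  have := sp1; case: (size p) => [|[|k]]// _.
  rewrite uphalfE /= ltnS => h.
  move: h; rewrite uphalf_half -{1}(odd_double_half k) ltn_add2l.
  by rewrite -addnn ltnNge leq_addr.
- exact: sqr_ge0.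
- move=> w wr; pose z := sqrtc w.
  have zw : z ^+ 2 = w by rewrite sqr_sqrtc.
  have zr : absC z = r.
    have : absC z ^+ 2 = r ^+ 2 by rewrite -absC_X zw.
    by move/eqP; rewrite eqrXn2 ?absC_ge0// => /eqP.
  have hp (t : C) : p.[t] = (even_poly p).[t ^+ 2] + (odd_poly p).[t ^+ 2] * t.
    by rewrite -{1}(poly_even_odd p) !hornerE !horner_comp !hornerE.
  have -> : (even_poly p).[w] = 2^-1%:C * (p.[z] + p.[- z]).
    rewrite !hp sqrrN zw; set e := (even_poly p).[w].
    rewrite mulrN addrACA subrr addr0 -mulr2n -[e *+ 2]mulr_natl mulrA.
    by rewrite -(rmorph_nat (real_complex R)) -rmorphM mulVf ?mul1r ?pnatr_eq0.
  rewrite absCM absC_real ger0_norm ?invr_ge0// ler_pdivrMl// mulr_natl mulr2n.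
  apply: le_trans (absCD _ _) _; apply: lerD; apply: pB => //.
  by rewrite absCN.
Qed.

(* An elementary substitute for entire functions, stable under sums and products. *)
Definition poly_approx (f : C -> C) := forall r e : R, 0 < e ->
  exists p : {poly C}, forall z, absC z <= r -> absC (f z - p.[z]) <= e.

Lemma poly_bounded (p : {poly C}) (r : R) :
  exists2 B, 0 < B & forall z, absC z <= r -> absC p.[z] <= B.
Proof.
elim/poly_ind: p => [|p c [B B0 pB]].
  by exists 1 => // z _; rewrite horner0 Normc.normc0.
exists (B * (`|r| + 1) + absC c).
  by rewrite ltr_pwDl ?absC_ge0// mulr_gt0// ltr_pwDr.
move=> z zr; rewrite !hornerE; apply: le_trans (absCD _ _) _.
rewrite lerD2r absCM ler_pM ?absC_ge0 ?pB//.
by rewrite (le_trans zr)// (le_trans (ler_norm _))// lerDl.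
Qed.

Lemma poly_approx_bounded f (r : R) : poly_approx f ->
  exists2 B, 0 < B & forall z, absC z <= r -> absC (f z) <= B.
Proof.
move=> /(_ r 1 ltr01)[p fp]; have [B B0 pB] := poly_bounded p r.
exists (1 + B) => [|z zr]; first by rewrite addr_gt0.
rewrite -(subrK p.[z] (f z)) (le_trans (absCD _ _))// lerD ?fp ?pB//.
Qed.

Lemma poly_approx_cst c : poly_approx (fun=> c).
Proof.
by move=> r e e0; exists c%:P => z _; rewrite hornerC subrr Normc.normc0 ltW.
Qed.

Lemma poly_approxD f g :
  poly_approx f -> poly_approx g -> poly_approx (fun z => f z + g z).
Proof.
move=> af ag r e e0; have e2 : 0 < e / 2 by rewrite divr_gt0.
have [p fp] := af r _ e2; have [q gq] := ag r _ e2.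
exists (p + q) => z zr; rewrite hornerD opprD addrACA.
by rewrite (le_trans (absCD _ _))// (splitr e) lerD ?fp ?gq.
Qed.

Lemma poly_approxM f g :
  poly_approx f -> poly_approx g -> poly_approx (fun z => f z * g z).
Proof.
move=> af ag r e e0.
(* The order matters: [q] is chosen against the bound [B] of [f], and only then [p] against the
   bound [D] of [q]. *)
have [B B0 fB] := poly_approx_bounded r af.
have [q gq] := ag r (e / 2 / B) (divr_gt0 (divr_gt0 e0 (ltr0Sn R 1)) B0).
have [D D0 qD] := poly_bounded q r.
have [p fp] := af r (e / 2 / D) (divr_gt0 (divr_gt0 e0 (ltr0Sn R 1)) D0).
exists (p * q) => z zr; rewrite hornerM.
have -> : f z * g z - p.[z] * q.[z] =
  f z * (g z - q.[z]) + (f z - p.[z]) * q.[z] by ring.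
rewrite (le_trans (absCD _ _))// (splitr e) !absCM lerD//.
  rewrite (le_trans (ler_pM (absC_ge0 _) (absC_ge0 _) (fB _ zr) (gq _ zr)))//.
  by rewrite mulrC divfK// gt_eqF.
rewrite (le_trans (ler_pM (absC_ge0 _) (absC_ge0 _) (fp _ zr) (qD _ zr)))//.
by rewrite divfK// gt_eqF.
Qed.

Lemma poly_approx_sum (I : Type) (s : seq I) (f : I -> C -> C) :
  (forall i, poly_approx (f i)) -> poly_approx (fun z => \sum_(i <- s) f i z).
Proof.
move=> af; elim: s => [|i s IH].
  by under eq_fun do rewrite big_nil; exact: poly_approx_cst.
by under eq_fun do rewrite big_cons; exact: poly_approxD.
Qed.

Lemma poly_approx_prod (I : Type) (s : seq I) (f : I -> C -> C) :
  (forall i, poly_approx (f i)) -> poly_approx (fun z => \prod_(i <- s) f i z).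
Proof.
move=> af; elim: s => [|i s IH].
  by under eq_fun do rewrite big_nil; exact: poly_approx_cst.
by under eq_fun do rewrite big_cons; exact: poly_approxM.
Qed.

Lemma poly_approx_det n (A : C -> 'M[C]_n) :
  (forall i j, poly_approx (fun z => A z i j)) ->
  poly_approx (fun z => \det (A z)).
Proof.
move=> aA; apply: poly_approx_sum => s.
apply: poly_approxM; first exact: poly_approx_cst.
by apply: poly_approx_prod.
Qed.

Lemma max_modulus f (r B : R) : 0 <= r -> poly_approx f ->
  (forall z, absC z = r -> absC (f z) <= B) -> absC (f 0) <= B.
Proof.
move=> r0 af fB; apply/ler_addgt0Pr => e e0.
have e2 : 0 < e / 2 by rewrite divr_gt0.
have [p fp] := af r _ e2.
have p0 : absC p.[0] <= B + e / 2.
  apply: (max_modulus_poly r0) => z zr.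
  rewrite -(subrKC (f z) p.[z]) (le_trans (absCD _ _))//.
  by rewrite lerD ?fB// -absCN opprB fp// zr.
rewrite -(subrK p.[0] (f 0)) (le_trans (absCD _ _))//.
have := fp 0; rewrite Normc.normc0 => /(_ r0) f0.
by rewrite (splitr e) addrA addrC lerD.
Qed.

End poly_approx.

(** * Fourier transforms of integrable functions *)

Section sign_iteration.
Context {R : realType}.

(* The iterates of this cubic converge boundedly to the sign on [-1, 1]; composed
   with [sin] they turn trigonometric polynomials into half-plane indicators. *)
Definition sgstep (t : R) : R := (3 * t - t ^+ 3) / 2.

Lemma sgstepN t : sgstep (- t) = - sgstep t.
Proof. by rewrite /sgstep; field. Qed.

Lemma iter_sgstepN n t : iter n sgstep (- t) = - iter n sgstep t.
Proof. by elim: n => //= n ->; rewrite sgstepN. Qed.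

(** The error [1 - u] is multiplied by [1 - u / 2 - u ^+ 2 / 2], at most [1 - t / 2] because the
    iterates increase from [t]. The rate degenerates as [t] tends to 0, so only pointwise
    convergence is drawn from it. *)
Lemma iter_sgstep_pos (t : R) n : 0 <= t <= 1 ->
  t <= iter n sgstep t <= 1 /\ 1 - iter n sgstep t <= (1 - t / 2) ^+ n.
Proof.
move=> /andP[t0 t1]; elim: n => [|n]; first by rewrite /= expr0; split; lra.
rewrite iterS; set u := iter n _ _ => -[/andP[tu u1] IH].
have u0 : 0 <= u by lra.
have eq1 : 1 - sgstep u = (1 - u) * ((1 - u) * (2 + u) / 2).
  by rewrite /sgstep; field.
have eq2 : sgstep u - u = u * (1 - u) * (1 + u) / 2 by rewrite /sgstep; field.
split.
  apply/andP; split.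
    suff : 0 <= sgstep u - u by lra.
    by rewrite eq2 !mulr_ge0//; lra.
  suff : 0 <= 1 - sgstep u by lra.
  by rewrite eq1 !mulr_ge0//; lra.
rewrite eq1 exprS mulrC ler_pM//; first by rewrite !mulr_ge0//; lra.
- by lra.
- have : 0 <= u * u by rewrite mulr_ge0.
  by nra.
Qed.

Lemma iter_sgstep_norm (t : R) n : `|t| <= 1 -> `|iter n sgstep t| <= 1.
Proof.
move=> t1; wlog t0 : t t1 / 0 <= t => [hw|].
  have [/hw->//|t0] := leP 0 t.
  by rewrite -normrN -iter_sgstepN hw ?normrN//; lra.
have /(@iter_sgstep_pos t n)[/andP[h1 h2] _] : 0 <= t <= 1.
  by rewrite t0 -(ger0_norm t0).
by rewrite ger0_norm//; lra.
Qed.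

Lemma cvg_iter_sgstep (t : R) : `|t| <= 1 ->
  (fun n => iter n sgstep t) @ \oo --> Num.sg t.
Proof.
move=> t1; wlog t0 : t t1 / 0 <= t => [hw|].
  have [t0|t0] := leP 0 t; first exact: hw.
  have -> : (fun n => iter n sgstep t) = (fun n => - iter n sgstep (- t)).
    by apply/funext => n; rewrite iter_sgstepN opprK.
  rewrite -[t in Num.sg t]opprK sgrN; apply: cvgN.
  by apply: hw; [rewrite normrN|lra].
have t01 : 0 <= t <= 1 by rewrite t0 -(ger0_norm t0).
move: t0; rewrite le_eqVlt => /predU1P[<-|t0].
  rewrite sgr0 (_ : (fun n => _) = cst 0); first exact: cvg_cst.
  apply/funext => n; apply/eqP; rewrite -[_ == _]/(_ == cst 0 n) /=.
  have := iter_sgstepN n 0; rewrite oppr0 => /eqP.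
  by rewrite -addr_eq0 -mulr2n mulrn_eq0.
rewrite gtr0_sg//.
have g0 : (fun n => (1 - t / 2) ^+ n) @ \oo --> (0 : R).
  by apply: cvg_expr; rewrite ger0_norm; lra.
have g1 : (fun n => 1 - (1 - t / 2) ^+ n) @ \oo --> (1 : R).
  by rewrite -[X in _ --> X]subr0; apply: cvgB => //; exact: cvg_cst.
apply: (@squeeze_cvgr _ _ _ _ (fun n => 1 - (1 - t / 2) ^+ n) (cst 1)) => //.
  by apply: nearW => n; have [/andP[]] := iter_sgstep_pos n t01; rewrite /=; lra.
exact: cvg_cst.
Qed.

End sign_iteration.

(** * Real integrable functions and dominated convergence *)

Section real_integrable.
Context d (T : measurableType d) (R : realType).
Variable mu : {measure set T -> \bar R}.
Implicit Types f g h : T -> R.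

Definition Rintegrable f := mu.-integrable setT (EFin \o f).

Lemma Rintegrable_measurable f : Rintegrable f -> measurable_fun setT f.
Proof. by move/measurable_int/measurable_EFinP. Qed.

Lemma Rintegrable_le f g : measurable_fun setT f ->
  (forall w, `|f w| <= g w) -> Rintegrable g -> Rintegrable f.
Proof.
move=> mf fg; apply: le_integrable => //; first exact/measurable_EFinP.
move=> w _ /=; rewrite lee_fin (le_trans (fg w))// ler_norm//.
Qed.

Lemma RintegrableD f g : Rintegrable f -> Rintegrable g ->
  Rintegrable (fun w => f w + g w).
Proof.
by move=> fi gi; apply: eq_integrable (integrableD measurableT fi gi).
Qed.

Lemma RintegrableZ (c : R) f : Rintegrable f -> Rintegrable (fun w => c * f w).
Proof. by move=> fi; apply: eq_integrable (integrableZl measurableT c fi). Qed.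

Lemma RintegrableB f g : Rintegrable f -> Rintegrable g ->
  Rintegrable (fun w => f w - g w).
Proof.
by move=> fi gi; apply: eq_integrable (integrableB measurableT fi gi).
Qed.

Lemma Rintegrable_norm f : Rintegrable f -> Rintegrable (fun w => `|f w|).
Proof. exact: integrable_norm. Qed.

Lemma RintegrableM f g (M : R) : Rintegrable f -> measurable_fun setT g ->
  (forall w, `|g w| <= M) -> Rintegrable (fun w => f w * g w).
Proof.
move=> fi mg gM; apply: (@Rintegrable_le _ (fun w => M * `|f w|)).
- exact: measurable_funM (Rintegrable_measurable fi) mg.
- by move=> w; rewrite normrM mulrC ler_wpM2r.
- exact/RintegrableZ/Rintegrable_norm.
Qed.

Lemma indic_le1 (A : set T) w : `|\1_A w : R| <= 1.
Proof. by rewrite indicE; case: (_ \in _); rewrite ?normr1 ?normr0. Qed.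

Lemma Rintegrable_indic f A : Rintegrable f -> measurable A ->
  Rintegrable (fun w => f w * \1_A w).
Proof.
move=> fi mA; apply: RintegrableM fi _ (indic_le1 A).
exact: measurable_indic.
Qed.

Lemma Rintegral_norm_le f g : Rintegrable f -> Rintegrable g ->
  (forall w, `|f w| <= g w) -> `|\int[mu]_w f w| <= \int[mu]_w g w.
Proof.
move=> fi gi fg; apply: le_trans (le_normr_Rintegral measurableT fi) _.
by apply: le_Rintegral => //; exact: Rintegrable_norm.
Qed.

(** Closedness in L^1 asks for one approximant per [e], hence a single index instead of a limit. *)
Lemma Rintegral_dominated (f g : T -> R) (f_ : nat -> T -> R) :
  (forall n, measurable_fun setT (f_ n)) -> Rintegrable g ->
  (forall n w, `|f_ n w| <= g w) ->
  (forall w, f_ n w @[n --> \oo] --> f w) ->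
  Rintegrable f /\ forall e : R, 0 < e -> exists n, \int[mu]_w `|f w - f_ n w| <= e.
Proof.
move=> mf_ gi fg f_f.
have mf : measurable_fun setT f.
  apply: (@measurable_fun_cvg _ _ _ _ f_) => // w _; exact: f_f.
have [|||||fi cv0 _] := @dominated_convergence _ T R mu setT measurableT
    (fun n => EFin \o f_ n) (EFin \o f) (EFin \o g).
- by move=> n; exact/measurable_EFinP.
- exact/measurable_EFinP.
- by apply: aeW => w _; apply: cvg_EFin; [exact: nearW|exact: f_f].
- exact: gi.
- by apply: aeW => w n _; rewrite /= lee_fin.
split => // e e0.
have f_i n : Rintegrable (f_ n) by exact: Rintegrable_le (mf_ n) (fg n) gi.
move/fine_cvgP : cv0 => [_ /cvgrPdist_le/(_ e e0)[N _ /(_ N (leqnn N))]].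
rewrite sub0r normrN => h; exists N; apply: le_trans _ (le_trans (ler_norm _) h).
rewrite le_eqVlt; apply/predU1P; left; apply: eq_Rintegral => w _.
by rewrite distrC.
Qed.

End real_integrable.

(** * Closed classes of integrable functions invariant under waves *)

Section wave_class.
Context d (T : measurableType d) (R : realType).
Variable mu : {measure set T -> \bar R}.
Variables X Y : T -> R.
Hypotheses (mX : measurable_fun setT X) (mY : measurable_fun setT Y).

(** The phase [c] puts cosines and sines ([c = - pi / 2]) into one real family, which products
    preserve up to linear combinations ([waveM]). *)
Definition wave (s t c : R) (w : T) : R := cos (s * X w + t * Y w + c).

Lemma measurable_wave s t c : measurable_fun setT (wave s t c).
Proof.
apply: (@measurableT_comp _ _ _ _ _ _ (@cos R)).
  by apply: continuous_measurable_fun => x; exact: continuous_cos.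
apply: measurable_funD => //.
apply: measurable_funD; apply: measurable_funM => //.
Qed.

Lemma wave_le1 s t c w : `|wave s t c w| <= 1.
Proof. by rewrite ler_norml cos_geN1 cos_le1. Qed.

Lemma Rintegrable_wave h s t c : Rintegrable mu h ->
  Rintegrable mu (fun w => h w * wave s t c w).
Proof.
by move=> hi; apply: RintegrableM hi (measurable_wave _ _ _) (wave_le1 _ _ _).
Qed.

Lemma waveM s t c s' t' c' w :
  wave s t c w * wave s' t' c' w =
  2^-1 * (wave (s + s') (t + t') (c + c') w + wave (s - s') (t - t') (c - c') w).
Proof.
rewrite /wave; set p := s * _ + _ + _; set q := s' * _ + _ + _.
have -> : (s + s') * X w + (t + t') * Y w + (c + c') = p + q by rewrite /p /q; ring.
have -> : (s - s') * X w + (t - t') * Y w + (c - c') = p - q by rewrite /p /q; ring.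
by rewrite (cosD p q) (cosB p q); field.
Qed.

(** [V] will be the class of functions with zero Fourier transform, then that of functions whose
    transform tends to 0 at infinity. Multiplication by a wave only translates frequencies, which
    preserves both properties. *)
Variable V : (T -> R) -> Prop.
Hypothesis V_int : forall h, V h -> Rintegrable mu h.
Hypothesis VD : forall h k, V h -> V k -> V (fun w => h w + k w).
Hypothesis VZ : forall c h, V h -> V (fun w => c * h w).
Hypothesis V_wave : forall h s t c, V h -> V (fun w => h w * wave s t c w).
Hypothesis V_closed : forall h, Rintegrable mu h ->
  (forall e : R, 0 < e -> exists2 k, V k & \int[mu]_w `|h w - k w| <= e) -> V h.

(* The multipliers of a linear, L^1-closed, wave-invariant class form an algebra
   closed under bounded pointwise limits, so they contain all Borel indicators. *)
Definition multiplier (f : T -> R) :=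
  (exists M : R, forall w, `|f w| <= M) /\ forall h, V h -> V (fun w => h w * f w).

Lemma multiplier_cst c : multiplier (fun=> c).
Proof.
split; first by exists `|c|.
move=> h /(VZ c); congr V; apply/funext => w; exact: mulrC.
Qed.

Lemma multiplierD f g : multiplier f -> multiplier g ->
  multiplier (fun w => f w + g w).
Proof.
move=> [[M fM] fV] [[N gN] gV]; split.
  by exists (M + N) => w; rewrite (le_trans (ler_normD _ _))// lerD.
move=> h Vh; have := VD (fV _ Vh) (gV _ Vh).
by congr V; apply/funext => w; rewrite mulrDr.
Qed.

Lemma multiplierM f g : multiplier f -> multiplier g ->
  multiplier (fun w => f w * g w).
Proof.
move=> [[M fM] fV] [[N gN] gV]; split.
  by exists (M * N) => w; rewrite normrM ler_pM.
move=> h Vh; have := gV _ (fV _ Vh).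
by congr V; apply/funext => w; rewrite mulrA.
Qed.

Lemma multiplierZ c f : multiplier f -> multiplier (fun w => c * f w).
Proof. exact/multiplierM/multiplier_cst. Qed.

Lemma multiplier_wave s t c : multiplier (wave s t c).
Proof. by split; [exists 1; exact: wave_le1|move=> h; exact: V_wave]. Qed.

Lemma multiplier_lim (f : T -> R) (f_ : nat -> T -> R) (M : R) :
  (forall n, multiplier (f_ n)) -> (forall n w, `|f_ n w| <= M) ->
  (forall w, f_ n w @[n --> \oo] --> f w) -> multiplier f.
Proof.
move=> mf fM f_f; split.
  exists M => w; apply: (closed_cvg (fun x : R => x <= M) (@closed_le _ M) _ _
    (cvg_norm (f_f w))).
  by apply: nearW => n; exact: fM.
move=> h Vh; have hi := V_int Vh.
have [||||ki kn] := @Rintegral_dominated _ _ _ mu (fun w => h w * f w)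
  (fun w => M * `|h w|) (fun n w => h w * f_ n w).
- by move=> n; exact/Rintegrable_measurable/V_int/(mf n).2.
- exact/RintegrableZ/Rintegrable_norm.
- by move=> n w; rewrite normrM mulrC ler_wpM2r.
- by move=> w; apply: cvgM; [exact: cvg_cst|exact: f_f].
apply: V_closed => // e e0; have [n hn] := kn _ e0.
by exists (fun w => h w * f_ n w) => //; exact: (mf n).2.
Qed.

Lemma multiplier_sgstep f : multiplier f -> multiplier (fun w => sgstep (f w)).
Proof.
move=> mf.
have := multiplierD (multiplierZ (3 / 2) mf)
  (multiplierZ (- 2^-1) (multiplierM mf (multiplierM mf mf))).
by congr multiplier; apply/funext => w; rewrite /sgstep; field.
Qed.

Lemma multiplier_sg f : multiplier f -> (forall w, `|f w| <= 1) ->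
  multiplier (fun w => Num.sg (f w)).
Proof.
move=> mf f1; apply: (@multiplier_lim _ (fun n w => iter n sgstep (f w)) 1).
- by elim=> [//|n IH]; exact: multiplier_sgstep.
- by move=> n w; exact: iter_sgstep_norm.
- by move=> w; exact: cvg_iter_sgstep.
Qed.

(** With growing wavelength, [sin (u / n.+1)] has the sign of [u] as soon as [|u| / n.+1 < pi], so
    the signs are eventually constant in [n]. *)
Lemma multiplier_sg_linear s t c :
  multiplier (fun w => Num.sg (s * X w + t * Y w + c)).
Proof.
pose k (n : nat) : R := n.+1%:R^-1.
apply: (@multiplier_lim _
  (fun n w => Num.sg (wave (k n * s) (k n * t) (k n * c - pi / 2) w)) 1).
- by move=> n; apply: multiplier_sg (wave_le1 _ _ _); exact: multiplier_wave.
- by move=> n w; rewrite normr_sg lern1 leq_b1.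
move=> w; set u := s * X w + t * Y w + c.
apply: cvg_near_cst.
have waveE n : wave (k n * s) (k n * t) (k n * c - pi / 2) w = sin (k n * u).
  rewrite /wave -cosBpihalf; congr cos; rewrite /u; ring.
near=> n; rewrite waveE.
have k0 : 0 < k n by rewrite invr_gt0.
have kpi : k n * `|u| < pi.
  rewrite mulrC ltr_pdivrMr// mulrC -ltr_pdivrMr ?pi_gt0//.
  near: n; apply: filterS (nbhs_infty_gtr (`|u| / pi)) => n h.
  by rewrite (lt_trans h)// ltr_nat.
have [u0|u0|u0] := ltrgtP 0 u; last by rewrite -u0 mulr0 sin0.
- rewrite (gtr0_sg u0) gtr0_sg// sin_gt0_pi// mulr_gt0//=.
  by rewrite -[X in _ * X < _](gtr0_norm u0).
- rewrite (ltr0_sg u0) ltr0_sg// -oppr_gt0 -sinN sin_gt0_pi//.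
  by rewrite -mulrN mulr_gt0 ?oppr_gt0//= -(ltr0_norm u0).
Unshelve. all: by end_near. Qed.

Lemma multiplier_halfplane s t c :
  multiplier (\1_[set w | c < s * X w + t * Y w]).
Proof.
have mu1 := multiplier_sg_linear s t (- c).
(* [(sg + sg ^+ 2) / 2] is 1 on positive values and 0 elsewhere, including at 0. *)
have := multiplierZ 2^-1 (multiplierD mu1 (multiplierM mu1 mu1)).
congr multiplier; apply/funext => w; rewrite indicE.
have [h|h|h] := ltrgtP c (s * X w + t * Y w).
- by rewrite mem_set//= gtr0_sg ?subr_gt0//; field.
- by rewrite memNset/= ?ltr0_sg ?subr_lt0//; [field|apply/negP; rewrite -leNgt ltW].
- by rewrite memNset/= -?h ?subrr ?sgr0 ?ltxx//; field.
Qed.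

Lemma multiplier_setC A : multiplier (\1_A) -> multiplier (\1_(~` A)).
Proof.
move=> mA; have := multiplierD (multiplier_cst 1) (multiplierZ (-1) mA).
congr multiplier; apply/funext => w; rewrite !indicE in_setC.
by case: (_ \in _); rewrite /= ?mulr1 ?mulr0; ring.
Qed.

Lemma multiplier_setI A B : multiplier (\1_A) -> multiplier (\1_B) ->
  multiplier (\1_(A `&` B)).
Proof.
by move=> mA mB; have := multiplierM mA mB; congr multiplier;
  rewrite indicI.
Qed.

Lemma multiplier_bigcup (A : (set T)^nat) : (forall n, multiplier (\1_(A n))) ->
  multiplier (\1_(\bigcup_n A n)).
Proof.
move=> mA; apply: (@multiplier_lim _ (fun n => \1_(\big[setU/set0]_(i < n) A i)) 1).
- move=> n; elim: n => [|n IH].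
    rewrite big_ord0 -[set0]setCK setC0; apply: multiplier_setC.
    by rewrite indicT; exact: multiplier_cst.
  rewrite big_ord_recr/= -[X in \1_X]setCK setCU.
  by apply/multiplier_setC/multiplier_setI; exact: multiplier_setC.
- by move=> n w; exact: indic_le1.
move=> w; apply: cvg_near_cst.
have [[m _ Am]|nA] := pselect ((\bigcup_n A n) w).
  exists m.+1 => // n /= mn; rewrite !indicE !mem_set//; first by exists m.
  by rewrite -bigcup_mkord; exists m.
apply: nearW => n; rewrite !indicE !memNset//.
by rewrite -bigcup_mkord => -[i /= _ Ai]; apply: nA; exists i.
Qed.

Local Notation RR := (measurableTypeR R * measurableTypeR R)%type.

Lemma multiplier_borel (B : set RR) : measurable B ->
  multiplier (\1_[set w | B (X w, Y w)]).
Proof.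
pose S := [set B : set RR | multiplier (\1_[set w | B (X w, Y w)])].
have sS : sigma_algebra setT S.
  split.
  - rewrite /S /= (_ : [set _ | _] = ~` setT); last by rewrite setCT.
    by apply: multiplier_setC; rewrite indicT; exact: multiplier_cst.
  - by move=> A; rewrite setTD => /multiplier_setC.
  - by move=> A mA; apply: multiplier_bigcup => n; exact: mA.
(* Both coordinates are linear forms, so one argument serves: open rays generate the Borel sets of
   the line, and their preimages are half-planes. *)
have sub (f : RR -> R) (s t : R) : (forall p, f p = s * p.1 + t * p.2) ->
    forall D : set R, measurable D -> S (f @^-1` D).
  move=> fE D mD.
  suff : (@RGenOInfty.G R).-sigma.-measurable `<=` [set D | S (f @^-1` D)].
    by rewrite -RGenOInfty.measurableE; exact.
  have [S0 SD SU] := sS; apply: smallest_sub.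
    split; first by rewrite /= preimage_set0.
    - by move=> A SA; rewrite /= setTD preimage_setC -setTD; exact: SD.
    - by move=> A SA; rewrite /= preimage_bigcup; exact: SU.
  move=> _ [x ->]; rewrite /S /=.
  have := multiplier_halfplane s t x; congr multiplier; congr (\1_ _).
  by apply/funext => w; rewrite /= fE in_itv/= andbT.
suff : measurable `<=` S by exact.
apply: smallest_sub => // _ [[D mD <-]|[D mD <-]]; rewrite setTI.
- by apply: (sub _ 1 0) => // p; rewrite mul1r mul0r addr0.
- by apply: (sub _ 0 1) => // p; rewrite mul1r mul0r add0r.
Qed.


(** Multipliers reach only the sigma-algebra generated by [X] and [Y]. This condition says that the
    one on [T] exceeds it by null sets only, as happens for a completed measure. *)
Definition borel_mod0 := forall A : set T, measurable A ->
  exists2 B : set RR, measurable B &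
    mu.-negligible ((A `\` [set w | B (X w, Y w)]) `|`
                    ([set w | B (X w, Y w)] `\` A)).

Lemma class_ae_eq h k : V h -> Rintegrable mu k ->
  {ae mu, forall w, k w = h w} -> V k.
Proof.
move=> Vh ki kh; apply: V_closed => // e e0; exists h => //.
rewrite (_ : \int[mu]_w _ = 0) ?ltW// /Rintegral.
rewrite (ae_eq_integral (cst 0)) ?integral0//.
- apply/measurable_EFinP; apply: measurableT_comp => //.
  apply: measurable_funB; first exact: Rintegrable_measurable ki.
  exact/Rintegrable_measurable/V_int.
- by apply: filterS kh => w -> _; rewrite subrr normr0.
Qed.

Lemma class_measurable h A : borel_mod0 -> V h -> measurable A ->
  V (fun w => h w * \1_A w).
Proof.
move=> bor Vh mA; have [B mB AB] := bor _ mA.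
apply: class_ae_eq ((multiplier_borel mB).2 _ Vh) _ _.
  exact: Rintegrable_indic (V_int Vh) mA.
apply: negligibleS AB => w /= neq; have [Aw|nAw] := pselect (A w).
- left; split => // Bw; apply: neq.
  by rewrite !indicE !mem_set.
- right; split => //; apply: contrapT => nBw; apply: neq.
  by rewrite !indicE !memNset.
Qed.

Lemma class_sum (I : Type) (s : seq I) (f : I -> T -> R) h : V h ->
  (forall i, V (f i)) -> V (fun w => \sum_(i <- s) f i w).
Proof.
move=> Vh Vf; elim: s => [|i s IH].
  rewrite (_ : (fun w => _) = (fun w => 0 * h w)); first exact: VZ.
  by apply/funext => w; rewrite big_nil mul0r.
by under eq_fun do rewrite big_cons; exact: VD.
Qed.

(** After truncation to [K n], [h] is approximated by simple functions supported there. These are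
    combinations of products of [\1_(K n)] with measurable indicators, so membership has to be
    checked on the exhausting sets alone. *)
Lemma class_full (K : nat -> set T) h : borel_mod0 ->
  (forall n, measurable (K n)) -> (forall n, V (\1_(K n))) ->
  (forall w, \forall n \near \oo, K n w) -> Rintegrable mu h -> V h.
Proof.
move=> bor mK VK Kw hi.
have [||||_ kn] := @Rintegral_dominated _ _ _ mu h (fun w => `|h w|)
  (fun n w => h w * \1_(K n) w).
- move=> n; apply: measurable_funM; first exact: Rintegrable_measurable hi.
  exact: measurable_indic.
- exact: Rintegrable_norm.
- by move=> n w; rewrite normrM ler_piMr// indic_le1.
- move=> w; apply: cvg_near_cst; apply: filterS (Kw w) => n Kn.
  by rewrite indicE mem_set// mulr1.
apply: V_closed => // e e0; have [n hn] := kn _ e0.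
exists (fun w => h w * \1_(K n) w) => // {kn hn e e0}.
apply: V_closed.
  exact: Rintegrable_indic.
move=> e e0; have [g [gi _ gcv]] := approximation_sfun_integrable measurableT hi.
move/fine_cvgP : gcv => [_ /cvgrPdist_le/(_ e e0)[N _ /(_ N (leqnn N))]].
rewrite sub0r normrN => gN; exists (fun w => \1_(K n) w * g N w).
  have gE w : \1_(K n) w * g N w =
      \sum_(y <- finmap.enum_fset (fset_set (range (g N))))
      (y * (\1_(K n) w * \1_(g N @^-1` [set y]) w)).
    rewrite [in LHS](fimfunE (g N) w) fsbig_finite// mulr_sumr.
    by apply: eq_bigr => y _; rewrite mulrCA.
  under eq_fun do rewrite gE.
  by apply: class_sum (VK n) _ => y; apply/VZ/class_measurable.
apply: le_trans (le_trans (ler_norm _) gN).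
apply: le_Rintegral => //.
- apply: Rintegrable_norm; apply: RintegrableB.
    exact: Rintegrable_indic.
  have := Rintegrable_indic (gi N) (mK n).
  by congr Rintegrable; apply/funext => w; rewrite mulrC.
- by apply: Rintegrable_norm; apply: RintegrableB => //; exact: gi.
- move=> w _; rewrite (mulrC (\1_ _ _)) -mulrBl normrM.
  by rewrite ler_piMr// indic_le1.
Qed.

End wave_class.

(** * Functions with vanishing or decaying Fourier transform *)

Section spectrum.
Context d (T : measurableType d) (R : realType).
Variable mu : {measure set T -> \bar R}.
Variables X Y : T -> R.
Hypotheses (mX : measurable_fun setT X) (mY : measurable_fun setT Y).
Local Notation wave := (wave X Y).

Lemma Rintegral_wave_close h k s t c : Rintegrable mu h -> Rintegrable mu k ->
  `|\int[mu]_w (h w * wave s t c w)| <=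
  `|\int[mu]_w (k w * wave s t c w)| + \int[mu]_w `|h w - k w|.
Proof.
move=> hi ki; rewrite -lerBlDl.
apply: le_trans (lerB_dist _ _) _.
have iw (f : T -> R) : Rintegrable mu f ->
    Rintegrable mu (fun w => f w * wave s t c w).
  exact: Rintegrable_wave.
rewrite -RintegralB//; [|exact: iw|exact: iw].
apply: Rintegral_norm_le.
- by apply: RintegrableB; exact: iw.
- exact/Rintegrable_norm/RintegrableB.
- by move=> w; rewrite -mulrBl normrM ler_piMr// wave_le1.
Qed.

Lemma Rintegral_waveM h s t c s' t' c' : Rintegrable mu h ->
  \int[mu]_w (h w * wave s t c w * wave s' t' c' w) =
  2^-1 * (\int[mu]_w (h w * wave (s + s') (t + t') (c + c') w) +
          \int[mu]_w (h w * wave (s - s') (t - t') (c - c') w)).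
Proof.
move=> hi; have iw := fun s t c => Rintegrable_wave mX mY s t c hi.
rewrite -(RintegralD measurableT (iw _ _ _) (iw _ _ _)).
rewrite -(RintegralZl _ measurableT (RintegrableD (iw _ _ _) (iw _ _ _))).
by apply: eq_Rintegral => w _; rewrite -mulrA waveM mulrCA mulrDr.
Qed.

Lemma Rintegral_waveD h k s t c : Rintegrable mu h -> Rintegrable mu k ->
  \int[mu]_w ((h w + k w) * wave s t c w) =
  \int[mu]_w (h w * wave s t c w) + \int[mu]_w (k w * wave s t c w).
Proof.
move=> hi ki; rewrite -RintegralD//; last 2 first.
  exact: Rintegrable_wave. exact: Rintegrable_wave.
by apply: eq_Rintegral => w _; rewrite mulrDl.
Qed.

Lemma Rintegral_waveZ a h s t c : Rintegrable mu h ->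
  \int[mu]_w (a * h w * wave s t c w) = a * \int[mu]_w (h w * wave s t c w).
Proof.
move=> hi; rewrite -RintegralZl//; last exact: Rintegrable_wave.
by apply: eq_Rintegral => w _; rewrite mulrA.
Qed.

Definition wave_null (h : T -> R) := Rintegrable mu h /\
  forall s t c, \int[mu]_w (h w * wave s t c w) = 0.

Definition wave_decay (h : T -> R) := Rintegrable mu h /\
  forall e : R, 0 < e -> exists r : R, forall s t c, r <= `|s| + `|t| ->
    `|\int[mu]_w (h w * wave s t c w)| <= e.

Lemma wave_null_ae h : borel_mod0 mu X Y -> wave_null h ->
  {ae mu, forall w, h w = 0}.
Proof.
move=> bor hV.
have hA A : measurable A -> wave_null (fun w => h w * \1_A w).
  apply: (@class_measurable _ _ _ mu X Y wave_null _ _ _ _ _ h A bor hV).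
  - by move=> f [].
  - move=> f g [fi f0] [gi g0]; split; first exact: RintegrableD.
    by move=> s t c; rewrite Rintegral_waveD// f0 g0 addr0.
  - move=> a f [fi f0]; split; first exact: RintegrableZ.
    by move=> s t c; rewrite Rintegral_waveZ// f0 mulr0.
  - move=> f s t c [fi f0]; split; first exact: Rintegrable_wave.
    by move=> s' t' c'; rewrite Rintegral_waveM// !f0 addr0 mulr0.
  - move=> f fi fk; split => // s t c; apply/eqP; rewrite -normr_le0.
    apply/ler_addgt0Pr => e e0; rewrite add0r.
    have [k [ki k0] fke] := fk _ e0.
    apply: le_trans (Rintegral_wave_close s t c fi ki) _.
    by rewrite k0 normr0 add0r.
have hi := hV.1.
suff : ae_eq mu setT (EFin \o h) (cst 0%E).
  by apply: filterS => w /(_ I) /= [].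
apply: integral_ae_eq => // E _ mE; rewrite integral0.
(* Zero frequency and zero phase turn the wave into 1, leaving the integral of [h] over [E]. *)
have [Ei /(_ 0 0 0)] := hA _ mE.
under eq_Rintegral do rewrite /wave !mul0r !addr0 cos0 mulr1.
rewrite /Rintegral => /eqP; rewrite fine_eq0; last exact: integrable_fin_num.
move=> /eqP h0; rewrite -[RHS]h0 integral_mkcond; apply: eq_integral => w _.
by rewrite /patch indicE; case: (_ \in _); rewrite /= ?mulr1 ?mulr0.
Qed.

Lemma riemann_lebesgue (K : nat -> set T) h : borel_mod0 mu X Y ->
  (forall n, measurable (K n)) -> (forall n, wave_decay (\1_(K n))) ->
  (forall w, \forall n \near \oo, K n w) -> Rintegrable mu h -> wave_decay h.
Proof.
move=> bor mK VK Kw; apply: (@class_full _ _ _ mu X Y wave_decay _ _ _ _ _ K) => //.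
- by move=> f [].
- move=> f g [fi fd] [gi gd]; split; first exact: RintegrableD.
  move=> e e0; have e2 : 0 < e / 2 by rewrite divr_gt0.
  have [r1 h1] := fd _ e2; have [r2 h2] := gd _ e2.
  exists (Num.max r1 r2) => s t c; rewrite ge_max.
  move=> /andP[/(h1 s t c) a1 /(h2 s t c) a2].
  rewrite Rintegral_waveD// (le_trans (ler_normD _ _))// (splitr e) lerD//.
- move=> a f [fi fd]; split; first exact: RintegrableZ.
  move=> e e0; have a0 : 0 < `|a| + 1 by rewrite ltr_pwDr.
  have [r hr] := fd _ (divr_gt0 e0 a0); exists r => s t c /(hr s t c).
  rewrite Rintegral_waveZ// normrM ler_pdivlMr// => /(le_trans _); apply.
  by rewrite mulrC ler_wpM2l// lerDl.
- move=> f s t c [fi fd]; split; first exact: Rintegrable_wave.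
  (* The product of waves has frequencies translated by [(s, t)] and by its opposite; enlarging the
     radius by [|s| + |t|] keeps both beyond [r]. *)
  move=> e e0; have [r hr] := fd _ e0; exists (r + `|s| + `|t|) => s' t' c' st.
  rewrite Rintegral_waveM// normrM ger0_norm ?invr_ge0// ler_pdivrMl//.
  rewrite mulr_natl mulr2n (le_trans (ler_normD _ _))// lerD// hr//.
    have := lerB_normD s' s; have := lerB_normD t' t.
    by rewrite (addrC s') (addrC t'); lra.
  have := lerB_dist s' s; have := lerB_dist t' t.
  by rewrite (distrC s') (distrC t'); lra.
- move=> f fi fk; split => // e e0; have e2 : 0 < e / 2 by rewrite divr_gt0.
  have [k [ki kd] fke] := fk _ e2; have [r hr] := kd _ e2.
  exists r => s t c /(hr s t c) h1.
  apply: le_trans (Rintegral_wave_close s t c fi ki) _.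
  by rewrite (splitr e) lerD.
Qed.

End spectrum.

(** * Two-sided Laplace transforms *)

Section exponential.
Context {R : realType}.
Local Notation C := R[i].
Local Notation absC := (@Normc.normc R).
Local Notation Re := (@complex.Re R).
Local Notation Im := (@complex.Im R).

(** The second-order Taylor estimates below feed first-order ones into this bound on the derivative,
    which gains a factor [|x|] but not the sharp constant. *)
Lemma norm_le_derive (f df : R -> R) (B x : R) :
  (forall y : R, is_derive y 1 f (df y)) -> f 0 = 0 ->
  (forall c, `|c| <= `|x| -> `|df c| <= B) -> `|f x| <= B * `|x|.
Proof.
move=> fd f0 dB.
have fc (a b : R) : {within `[a, b], continuous f}.
  apply: derivable_within_continuous => y _; have := fd y => fy.
  exact: ex_derive.
have [x0|x0] := leP 0 x.
  have [c] := MVT_segment x0 (fun y _ => fd y) (fc _ _).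
  rewrite in_itv/= => /andP[c0 cx]; rewrite f0 !subr0 => ->.
  by rewrite normrM ler_wpM2r// dB// !ger0_norm.
have [c] := MVT_segment (ltW x0) (fun y _ => fd y) (fc _ _).
rewrite in_itv/= => /andP[c0 cx]; rewrite f0 !sub0r => /(congr1 Num.norm).
rewrite normrN => ->; rewrite normrM normrN ler_wpM2r// dB//.
by rewrite !ler0_norm ?lerN2// ltW.
Qed.

Lemma norm_sin_le (x : R) : `|sin x| <= `|x|.
Proof.
rewrite -[leRHS]mul1r; apply: (@norm_le_derive _ cos); rewrite ?sin0//.
by move=> c _; rewrite ler_norml cos_geN1 cos_le1.
Qed.

Lemma norm_cosB1_le (x : R) : `|cos x - 1| <= `|x| ^+ 2.
Proof.
rewrite expr2; apply: (@norm_le_derive (fun x => cos x - 1) (fun x => - sin x)).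
- move=> y; rewrite -[- sin y]subr0.
  exact: (is_deriveB (is_derive_cos y) (is_derive_cst (1 : R) y 1)).
- by rewrite cos0 subrr.
- by move=> c cx; rewrite normrN (le_trans (norm_sin_le c)).
Qed.

Lemma norm_sinB_le (x : R) : `|sin x - x| <= `|x| ^+ 2.
Proof.
rewrite expr2; apply: (@norm_le_derive (fun x => sin x - x) (fun x => cos x - 1)).
- by rewrite sin0 subrr.
- move=> c cx; apply: le_trans cx; rewrite -[leRHS]mul1r.
  apply: (@norm_le_derive (fun x => cos x - 1) (fun x => - sin x)).
  + move=> y; rewrite -[- sin y]subr0.
    exact: (is_deriveB (is_derive_cos y) (is_derive_cst (1 : R) y 1)).
  + by rewrite cos0 subrr.
  + by move=> y _; rewrite normrN ler_norml sin_geN1 sin_le1.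
Qed.

Lemma norm_expRB1_le (x : R) : `|expR x - 1| <= expR `|x| * `|x|.
Proof.
apply: (@norm_le_derive (fun x => expR x - 1) (@expR R)).
- move=> y; rewrite -[expR y]subr0.
  exact: (is_deriveB (is_derive_expR y) (is_derive_cst (1 : R) y 1)).
- by rewrite expR0 subrr.
- move=> c cx; rewrite ger0_norm ?expR_ge0// ler_expR.
  by rewrite (le_trans (ler_norm _) cx).
Qed.

Lemma norm_expRB_le (x : R) : `|expR x - 1 - x| <= expR `|x| * `|x| ^+ 2.
Proof.
rewrite expr2 mulrA.
apply: (@norm_le_derive (fun x => expR x - 1 - x) (fun x => expR x - 1)).
- move=> y.
  have := is_deriveB (is_deriveB (is_derive_expR y) (is_derive_cst (1 : R) y 1))
    (is_derive_id y 1).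
  by rewrite subr0.
- by rewrite expR0 subrr subr0.
- move=> c cx; rewrite (le_trans (norm_expRB1_le c))//.
  by rewrite ler_pM ?expR_ge0 ?ler_expR.
Qed.

Lemma ReD (z w : C) : Re (z + w) = Re z + Re w.
Proof. by case: z w => a b [c d]. Qed.

Lemma ImD (z w : C) : Im (z + w) = Im z + Im w.
Proof. by case: z w => a b [c d]. Qed.

Lemma ReM (z w : C) : Re (z * w) = Re z * Re w - Im z * Im w.
Proof. by case: z w => a b [c d]. Qed.

Lemma ImM (z w : C) : Im (z * w) = Re z * Im w + Im z * Re w.
Proof. by case: z w => a b [c d]. Qed.

Lemma ReJ (z : C) : Re z^* = Re z. Proof. by case: z. Qed.

Lemma ImJ (z : C) : Im z^* = - Im z. Proof. by case: z. Qed.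

Lemma complex_ext (z w : C) : Re z = Re w -> Im z = Im w -> z = w.
Proof. by case: z w => a b [c d] /= -> ->. Qed.

Lemma Re_expC (z : C) : Re (expC z) = expR (Re z) * cos (Im z).
Proof. by rewrite /expC ReM /= mul0r subr0. Qed.

Lemma Im_expC (z : C) : Im (expC z) = expR (Re z) * sin (Im z).
Proof. by rewrite /expC ImM /= mul0r addr0. Qed.

Lemma expCD (z w : C) : expC (z + w) = expC z * expC w.
Proof.
apply: complex_ext.
  rewrite (ReM (expC z) (expC w)) !Re_expC !Im_expC ReD ImD expRD cosD; ring.
rewrite (ImM (expC z) (expC w)) !Re_expC !Im_expC ReD ImD expRD sinD; ring.
Qed.

Lemma expC0 : expC (0 : C) = 1.
Proof.
by apply: complex_ext;
  rewrite ?Re_expC ?Im_expC /= expR0 ?cos0 ?sin0 ?mulr1 ?mulr0.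
Qed.

Lemma expCX (z : C) n : expC z ^+ n = expC (z *+ n).
Proof.
elim: n => [|n IH]; first by rewrite expr0 mulr0n expC0.
by rewrite exprS IH -expCD mulrS.
Qed.

Lemma conjcM (z w : C) : (z * w)^* = z^* * w^*. Proof. exact: rmorphM. Qed.

Lemma conjcD (z w : C) : (z + w)^* = z^* + w^*. Proof. exact: rmorphD. Qed.

Lemma conjcB (z w : C) : (z - w)^* = z^* - w^*. Proof. exact: rmorphB. Qed.

Lemma conj_expC (z : C) : (expC z)^* = expC z^*.
Proof.
by apply: complex_ext; rewrite ?ReJ ?ImJ ?Re_expC ?Im_expC ?ReJ ?ImJ
  ?cosN ?sinN ?mulrN.
Qed.

Lemma absC_expC (z : C) : absC (expC z) = expR (Re z).
Proof.
rewrite /expC absCM absC_real ger0_norm ?expR_ge0//=.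
by rewrite cos2Dsin2 sqrtr1 mulr1.
Qed.

Lemma absC_expC_le (z : C) : absC (expC z) <= expR (absC z).
Proof.
by rewrite absC_expC ler_expR (le_trans (ler_norm _))// absC_Re.
Qed.

Lemma absC_1D_le (z : C) : absC (1 + z) <= expR (absC z).
Proof.
by rewrite (le_trans (absCD _ _))// Normc.normc1 expR_ge1Dx.
Qed.

(** The constant 4 counts two terms in each of the real and imaginary parts, every one at most
    [expR m * m ^+ 2] with [m] the modulus. *)
Lemma absC_expCB_le (z : C) :
  absC (expC z - (1 + z)) <= 4 * absC z ^+ 2 * expR (absC z).
Proof.
apply: le_trans (absC_le _) _.
have -> : Re (expC z - (1 + z)) =
    (expR (Re z) - 1 - Re z) + expR (Re z) * (cos (Im z) - 1).
  have -> : Re (expC z - (1 + z)) = Re (expC z) - (1 + Re z).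
    by case: (expC z) (z) => a b [].
  by rewrite Re_expC; ring.
have -> : Im (expC z - (1 + z)) =
    expR (Re z) * (sin (Im z) - Im z) + (expR (Re z) - 1) * Im z.
  have -> : Im (expC z - (1 + z)) = Im (expC z) - (0 + Im z).
    by case: (expC z) (z) => a b [].
  by rewrite Im_expC; ring.
have x2 := absC_Re z; have y2 := absC_Im z.
have m0 := absC_ge0 z; set m := absC z in x2 y2 m0 *.
set x := Re z in x2 *; set y := Im z in y2 *.
have E0 := expR_ge0 m.
have xx2 : `|x| ^+ 2 <= m ^+ 2 by rewrite lerXn2r// nnegrE.
have yy2 : `|y| ^+ 2 <= m ^+ 2 by rewrite lerXn2r// nnegrE.
have Ex : expR `|x| <= expR m by rewrite ler_expR.
have Ex' : `|expR x| <= expR m.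
  by rewrite ger0_norm ?expR_ge0// ler_expR (le_trans (ler_norm _)).
have b1 : `|expR x - 1 - x| <= expR m * m ^+ 2.
  by rewrite (le_trans (norm_expRB_le _))// ler_pM ?expR_ge0 ?sqr_ge0.
have b2 : `|expR x * (cos y - 1)| <= expR m * m ^+ 2.
  by rewrite normrM ler_pM// (le_trans (norm_cosB1_le _)).
have b3 : `|expR x * (sin y - y)| <= expR m * m ^+ 2.
  by rewrite normrM ler_pM// (le_trans (norm_sinB_le _)).
have b4 : `|(expR x - 1) * y| <= expR m * m ^+ 2.
  rewrite normrM expr2 mulrA ler_pM// (le_trans (norm_expRB1_le _))//.
  by rewrite ler_pM ?expR_ge0.
have := ler_normD (expR x - 1 - x) (expR x * (cos y - 1)).
have := ler_normD (expR x * (sin y - y)) ((expR x - 1) * y).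
have -> : 4 * m ^+ 2 * expR m = 4 * (expR m * m ^+ 2) by ring.
by lra.
Qed.

Lemma absC_subX_le (a b : C) (M : R) n : absC a <= M -> absC b <= M ->
  absC (a ^+ n.+1 - b ^+ n.+1) <= absC (a - b) * (n.+1%:R * M ^+ n).
Proof.
move=> aM bM; have M0 : 0 <= M := le_trans (absC_ge0 _) aM.
elim: n => [|n IH]; first by rewrite !expr1 expr0 !mulr1.
have -> : a ^+ n.+2 - b ^+ n.+2 =
   (a - b) * a ^+ n.+1 + b * (a ^+ n.+1 - b ^+ n.+1).
  by rewrite !exprS; ring.
apply: le_trans (absCD _ _) _; rewrite !absCM absC_X.
have -> : absC (a - b) * (n.+2%:R * M ^+ n.+1) =
   absC (a - b) * M ^+ n.+1 + M * (absC (a - b) * (n.+1%:R * M ^+ n)).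
  by rewrite -[n.+2]addn1 natrD exprS; ring.
apply: lerD; last by rewrite ler_pM ?absC_ge0.
by rewrite ler_wpM2l ?absC_ge0// lerXn2r// nnegrE absC_ge0.
Qed.

(** Quantitative form of Euler's limit: with [u = z / n.+1], the error of order [|u| ^+ 2] between
    [expC u] and [1 + u] is multiplied by [n.+1] when powers are taken. The bound is an exponential
    of [|z|] because that is what exponential moments can integrate; the exponent 3 absorbs
    [|z| ^+ 2] through [|z| <= expR |z|]. *)
Lemma expC_euler (z : C) n :
  absC (expC z - (1 + z / n.+1%:R) ^+ n.+1) <= n.+1%:R^-1 * (4 * expR (3 * absC z)).
Proof.
set N : R := n.+1%:R; have N0 : 0 < N by rewrite ltr0n.
set u := z / n.+1%:R.
have uE : absC u = absC z / N.
  by rewrite /u absCM Normc.normcV absC_nat.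
have zu : z = u *+ n.+1.
  by rewrite -mulr_natr /u divfK// pnatr_eq0.
rewrite {1}zu -expCX.
apply: le_trans (absC_subX_le _ (absC_expC_le u) (absC_1D_le u)) _.
have -> : expR (absC u) ^+ n = expR (absC u *+ n) by rewrite -expRM_natl ?mulr_natl.
apply: (@le_trans _ _ (4 * absC u ^+ 2 * expR (absC u) * (N * expR (absC u *+ n)))).
  by rewrite ler_wpM2r ?mulr_ge0 ?expR_ge0 ?(ltW N0)// absC_expCB_le.
have -> : 4 * absC u ^+ 2 * expR (absC u) * (N * expR (absC u *+ n)) =
    4 * (N * absC u ^+ 2) * expR (absC u *+ n.+1).
  by rewrite (mulrS (absC u)) expRD; ring.
have -> : absC u *+ n.+1 = absC z.
  by rewrite uE -mulr_natr divfK// gt_eqF.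
have -> : N * absC u ^+ 2 = N^-1 * absC z ^+ 2.
  by rewrite uE; field; rewrite gt_eqF.
rewrite mulrCA -mulrA ler_pM2l ?invr_gt0// -mulrA ler_pM2l//.
have -> : 3 * absC z = absC z + absC z + absC z by ring.
rewrite !expRD ler_wpM2r ?expR_ge0// expr2.
have h : absC z <= expR (absC z).
  by apply: le_trans (expR_ge1Dx _); rewrite lerDr.
by rewrite ler_pM ?absC_ge0.
Qed.

End exponential.

(** * Integration of complex-valued functions *)

Section complex_integral.
Context d (T : measurableType d) (R : realType).
Variable mu : {measure set T -> \bar R}.
Local Notation C := R[i].
Local Notation absC := (@Normc.normc R).
Local Notation Re := (@complex.Re R).
Local Notation Im := (@complex.Im R).
Implicit Types f g : T -> C.

Definition Cmeasurable f := measurable_fun setT (fun w => Re (f w)) /\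
  measurable_fun setT (fun w => Im (f w)).

Definition Cintegrable f := Rintegrable mu (fun w => Re (f w)) /\
  Rintegrable mu (fun w => Im (f w)).

Definition Cintegral f : C :=
  (\int[mu]_w Re (f w)) +i* (\int[mu]_w Im (f w)).

Lemma CmeasurableD f g : Cmeasurable f -> Cmeasurable g ->
  Cmeasurable (fun w => f w + g w).
Proof.
move=> [f1 f2] [g1 g2]; split.
  by under eq_fun do rewrite ReD; exact: measurable_funD.
by under eq_fun do rewrite ImD; exact: measurable_funD.
Qed.

Lemma CmeasurableM f g : Cmeasurable f -> Cmeasurable g ->
  Cmeasurable (fun w => f w * g w).
Proof.
move=> [f1 f2] [g1 g2]; split.
  by under eq_fun do rewrite ReM; apply: measurable_funB; exact: measurable_funM.
by under eq_fun do rewrite ImM; apply: measurable_funD; exact: measurable_funM.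
Qed.

Lemma Cmeasurable_cst c : Cmeasurable (fun=> c).
Proof. by split. Qed.

Lemma CmeasurableX f n : Cmeasurable f -> Cmeasurable (fun w => f w ^+ n).
Proof.
move=> mf; elim: n => [|n IH]; first exact: Cmeasurable_cst.
by under eq_fun do rewrite exprS; exact: CmeasurableM.
Qed.

Lemma CmeasurableJ f : Cmeasurable f -> Cmeasurable (fun w => (f w)^*).
Proof.
move=> [f1 f2]; split; first by under eq_fun do rewrite ReJ.
by under eq_fun do rewrite ImJ; exact: measurable_funN.
Qed.

Lemma Cmeasurable_expC f : Cmeasurable f -> Cmeasurable (fun w => expC (f w)).
Proof.
move=> [f1 f2].
have mE : measurable_fun setT (fun w => expR (Re (f w))).
  exact: measurableT_comp.
split.
  under eq_fun do rewrite Re_expC; apply: measurable_funM => //.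
  apply: (@measurableT_comp _ _ _ _ _ _ (@cos R)) => //.
  by apply: continuous_measurable_fun => x; exact: continuous_cos.
under eq_fun do rewrite Im_expC; apply: measurable_funM => //.
apply: (@measurableT_comp _ _ _ _ _ _ (@sin R)) => //.
by apply: continuous_measurable_fun => x; exact: continuous_sin.
Qed.

Lemma measurable_absC f : Cmeasurable f -> measurable_fun setT (fun w => absC (f w)).
Proof.
move=> [f1 f2].
have -> : (fun w => absC (f w)) =
    (fun w => Num.sqrt (Re (f w) ^+ 2 + Im (f w) ^+ 2)).
  by apply/funext => w; case: (f w).
apply: (@measurableT_comp _ _ _ _ _ _ (@Num.sqrt R)).
  by apply: continuous_measurable_fun => x; exact: sqrt_continuous.
by apply: measurable_funD; exact: measurable_funX.
Qed.

Lemma Cintegrable_le f (B : T -> R) : Cmeasurable f ->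
  (forall w, absC (f w) <= B w) -> Rintegrable mu B -> Cintegrable f.
Proof.
move=> [f1 f2] fB Bi; split; apply: Rintegrable_le Bi => // w.
  exact: le_trans (absC_Re _) (fB w).
exact: le_trans (absC_Im _) (fB w).
Qed.

Lemma Cintegral_le f (B : T -> R) : Cintegrable f ->
  (forall w, absC (f w) <= B w) -> Rintegrable mu B ->
  absC (Cintegral f) <= 2 * \int[mu]_w B w.
Proof.
move=> [f1 f2] fB Bi; apply: le_trans (absC_le _) _.
rewrite mulr_natl mulr2n /=; apply: lerD; apply: Rintegral_norm_le => // w.
  exact: le_trans (absC_Re _) (fB w).
exact: le_trans (absC_Im _) (fB w).
Qed.

Lemma CintegrableD f g : Cintegrable f -> Cintegrable g ->
  Cintegrable (fun w => f w + g w).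
Proof.
move=> [f1 f2] [g1 g2]; split.
  by under eq_fun do rewrite ReD; exact: RintegrableD.
by under eq_fun do rewrite ImD; exact: RintegrableD.
Qed.

Lemma CintegrableZ c f : Cintegrable f -> Cintegrable (fun w => c * f w).
Proof.
move=> [f1 f2]; split.
  by under eq_fun do rewrite ReM; apply: RintegrableB; exact: RintegrableZ.
by under eq_fun do rewrite ImM; apply: RintegrableD; exact: RintegrableZ.
Qed.

Lemma Cintegral_ext f g : f =1 g -> Cintegral f = Cintegral g.
Proof. by move=> /funext ->. Qed.

Lemma CintegralD f g : Cintegrable f -> Cintegrable g ->
  Cintegral (fun w => f w + g w) = Cintegral f + Cintegral g.
Proof.
move=> [f1 f2] [g1 g2]; apply: complex_ext; rewrite ?ReD ?ImD /=.
  by under eq_Rintegral do rewrite ReD; rewrite RintegralD.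
by under eq_Rintegral do rewrite ImD; rewrite RintegralD.
Qed.

Lemma CintegralZ c f : Cintegrable f ->
  Cintegral (fun w => c * f w) = c * Cintegral f.
Proof.
move=> [f1 f2]; apply: complex_ext; rewrite ?ReM ?ImM /=.
  under eq_Rintegral do rewrite ReM.
  by rewrite RintegralB ?RintegralZl//; exact: RintegrableZ.
under eq_Rintegral do rewrite ImM.
by rewrite RintegralD ?RintegralZl//; exact: RintegrableZ.
Qed.

Lemma Cintegral0 : Cintegral (fun=> 0) = 0.
Proof. by apply: complex_ext; rewrite /= Rintegral_cst ?mul0r. Qed.

Lemma CintegralB f g : Cintegrable f -> Cintegrable g ->
  Cintegral (fun w => f w - g w) = Cintegral f - Cintegral g.
Proof.
move=> fi gi; under Cintegral_ext do rewrite -mulN1r.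
rewrite CintegralD//; last exact: CintegrableZ.
by rewrite CintegralZ// mulN1r.
Qed.

Lemma Cintegral_sum (I : Type) (s : seq I) (F : I -> T -> C) :
  (forall i, Cintegrable (F i)) ->
  Cintegrable (fun w => \sum_(i <- s) F i w) /\
  Cintegral (fun w => \sum_(i <- s) F i w) = \sum_(i <- s) Cintegral (F i).
Proof.
move=> Fi; elim: s => [|i s [IH1 IH2]].
  rewrite big_nil; under eq_fun do rewrite big_nil; rewrite Cintegral0.
  by split => //; split; exact: integrable0.
rewrite big_cons; under eq_fun do rewrite big_cons; split.
  exact: CintegrableD.
by rewrite CintegralD// IH2.
Qed.

Lemma CintegralJ f : Cintegrable f ->
  (Cintegral f)^* = Cintegral (fun w => (f w)^*).
Proof.
move=> [f1 f2]; apply: complex_ext; rewrite ?ReJ ?ImJ /=.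
  by under [in RHS]eq_Rintegral do rewrite ReJ.
under [in RHS]eq_Rintegral do rewrite ImJ -mulN1r.
by rewrite RintegralZl// mulN1r.
Qed.

End complex_integral.

(** * Laplace transforms of functions with exponential moments *)

Section laplace.
Context d (T : measurableType d) (R : realType).
Variable mu : {measure set T -> \bar R}.
Local Notation C := R[i].
Local Notation absC := (@Normc.normc R).
Local Notation Re := (@complex.Re R).
Local Notation Im := (@complex.Im R).

Definition exp_moments (g U : T -> C) := [/\ Cmeasurable g, Cmeasurable U &
  forall a : R, Rintegrable mu (fun w => absC (g w) * expR (a * absC (U w)))].

Lemma exp_moments_integrable g U f (a : R) : exp_moments g U -> Cmeasurable f ->
  (forall w, absC (f w) <= absC (g w) * expR (a * absC (U w))) ->
  Cintegrable mu f.
Proof. by move=> [_ _ gi] mf fg; exact: Cintegrable_le mf fg (gi a). Qed.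

(** With [(1 + U w * z / N) ^+ N] in place of the exponential, the integral is a polynomial in [z]
    whose coefficients are moments of [U] against [g]; [expC_euler] bounds the error uniformly on
    the disc. *)
Lemma laplace_approx (g U : T -> C) : exp_moments g U ->
  poly_approx (fun z => Cintegral mu (fun w => g w * expC (U w * z))).
Proof.
move=> gU r e e0; have [mg mU gi] := gU.
(* The 3 is the exponent of [expC_euler]; the 8 below is its constant 4 times the 2 of
   [Cintegral_le]. *)
pose a := 3 * `|r|; pose B w := absC (g w) * expR (a * absC (U w)).
pose J := \int[mu]_w B w.
have J0 : 0 <= J.
  by apply: Rintegral_ge0 => w _; rewrite mulr_ge0 ?absC_ge0 ?expR_ge0.
pose n := Num.bound (8 * J / e).
have nP : 8 * J <= n.+1%:R * e.
  rewrite -ler_pdivrMr//.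
  have := @archi_boundP _ (8 * J / e) (divr_ge0 (mulr_ge0 (ler0n R 8) J0) (ltW e0)).
  by move/ltW/le_trans; apply; rewrite ler_nat.
have gUk k : Cintegrable mu (fun w => g w * U w ^+ k).
  apply: (@exp_moments_integrable g U _ k%:R) => //.
    exact/CmeasurableM/CmeasurableX.
  move=> w; rewrite absCM absC_X ler_wpM2l ?absC_ge0//.
  rewrite expRM_natl lerXn2r ?nnegrE ?absC_ge0 ?expR_ge0//.
  by apply: le_trans (expR_ge1Dx _); rewrite lerDr.
pose N : C := n.+1%:R.
pose c k : C := 'C(n.+1, k)%:R * N ^- k * Cintegral mu (fun w => g w * U w ^+ k).
exists (\poly_(k < n.+2) c k) => z zr.
have gE : (fun w => g w * (1 + U w * z / N) ^+ n.+1) = (fun w =>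
    \sum_(k <- index_enum 'I_n.+2)
       ('C(n.+1, k)%:R * N ^- k * z ^+ k) * (g w * U w ^+ k)).
  apply/funext => w; rewrite exprDn mulr_sumr; apply: eq_bigr => k _.
  by rewrite expr1n mul1r !exprMn exprVn -mulr_natl; ring.
have [gi1 gi2] := @Cintegral_sum _ _ _ mu _ (index_enum 'I_n.+2)
  (fun (k : 'I_n.+2) w => ('C(n.+1, k)%:R * N ^- k * z ^+ k) * (g w * U w ^+ k))
  (fun k => CintegrableZ _ (gUk k)).
have pE : (\poly_(k < n.+2) c k).[z] =
    Cintegral mu (fun w => g w * (1 + U w * z / N) ^+ n.+1).
  rewrite horner_poly gE gi2; apply: eq_bigr => k _.
  by rewrite CintegralZ// /c; ring.
have zr' : absC z <= `|r| by rewrite (le_trans zr)// ler_norm.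
have gexp : Cintegrable mu (fun w => g w * expC (U w * z)).
  apply: (@exp_moments_integrable g U _ `|r|) => //.
    apply/CmeasurableM => //; apply: Cmeasurable_expC.
    exact/CmeasurableM/Cmeasurable_cst.
  move=> w; rewrite absCM ler_wpM2l ?absC_ge0//.
  rewrite (le_trans (absC_expC_le _))// ler_expR absCM mulrC.
  by rewrite ler_wpM2r ?absC_ge0.
rewrite pE -CintegralB//; last by rewrite gE.
have BB w : absC (g w * expC (U w * z) - g w * (1 + U w * z / N) ^+ n.+1) <=
    4 / n.+1%:R * B w.
  rewrite -mulrBr absCM /B mulrCA ler_wpM2l ?absC_ge0//.
  apply: le_trans (expC_euler _ _) _.
  rewrite mulrA [_^-1 * 4]mulrC ler_wpM2l ?divr_ge0// ler_expR absCM /a -mulrA.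
  by rewrite ler_wpM2l// mulrC ler_wpM2r ?absC_ge0.
have Bi : Rintegrable mu (fun w => 4 / n.+1%:R * B w) by exact/RintegrableZ/gi.
apply: le_trans (Cintegral_le _ BB Bi) _.
  under eq_fun do rewrite -[X in _ + X]mulN1r.
  by apply: CintegrableD => //; apply: CintegrableZ; rewrite gE.
rewrite RintegralZl//; last exact: gi.
rewrite -/J mulrA (_ : 2 * (4 / n.+1%:R) * J = 8 * J / n.+1%:R); last by field.
by rewrite ler_pdivrMr// [e * _]mulrC.
Qed.

Lemma exp_momentsJ g U : exp_moments g U -> exp_moments (fun w => (g w)^*) U.
Proof.
move=> [mg mU gi]; split => //; first exact: CmeasurableJ.
by move=> a; under eq_fun do rewrite absCJ.
Qed.

Lemma exp_momentsN g U : exp_moments g U -> exp_moments g (fun w => - U w).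
Proof.
move=> [mg mU gi]; split => //.
  under eq_fun do rewrite -mulN1r; exact/CmeasurableM/mU/Cmeasurable_cst.
by move=> a; under eq_fun do rewrite absCN.
Qed.

(** This absorbs a base point of the Laplace transform into the weight, so that only the
    displacement remains in the exponential. *)
Lemma exp_moments_exp g U (al be : C) : exp_moments g U ->
  exp_moments (fun w => g w * expC (U w * al + (U w)^* * be)) U.
Proof.
move=> [mg mU gi].
have mE : Cmeasurable (fun w => g w * expC (U w * al + (U w)^* * be)).
  apply: CmeasurableM => //; apply: Cmeasurable_expC; apply: CmeasurableD.
    exact/CmeasurableM/Cmeasurable_cst.
  exact/CmeasurableM/Cmeasurable_cst/CmeasurableJ.
split => // a; apply: (@Rintegrable_le _ _ _ _ _ _ _ _ (gi (a + absC al + absC be))).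
  apply: measurable_funM; first exact: measurable_absC.
  apply: measurableT_comp => //; apply: measurable_funM => //.
  exact: measurable_absC.
move=> w; rewrite ger0_norm ?mulr_ge0 ?absC_ge0 ?expR_ge0//.
rewrite absCM -mulrA ler_wpM2l ?absC_ge0//.
apply: (@le_trans _ _ (expR (absC (U w * al + (U w)^* * be)) *
  expR (a * absC (U w)))); first by rewrite ler_wpM2r ?expR_ge0 ?absC_expC_le.
rewrite -expRD ler_expR.
by have := absCD (U w * al) ((U w)^* * be); rewrite !absCM absCJ; lra.
Qed.

Lemma exp_moments_int g U : exp_moments g U -> Cintegrable mu g.
Proof.
move=> gU; have [mg _ _] := gU; apply: (exp_moments_integrable (a := 0) gU mg).
by move=> w; rewrite mul0r expR0 mulr1.
Qed.

Variables X Y : T -> R.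
Hypotheses (mX : measurable_fun setT X) (mY : measurable_fun setT Y).
Local Notation W := (fun w => X w +i* Y w).
Local Notation osc g s t c := (\int[mu]_w (g w * wave X Y s t c w)).

(** The exponent is [2 i] times [X * Im z + Y * Re z], the imaginary part of [W * z], hence the
    frequencies [s] and [t]; the phase [q] turns the cosine into the sine. *)
Lemma Cintegral_osc (g : T -> C) (z : C) : Cintegrable mu g ->
  let s := 2 * Im z in let t := 2 * Re z in let q := - (pi / 2) in
  Cintegral mu (fun w => g w * expC (W w * z - (W w * z)^*)) =
  (osc (Re \o g) s t 0 - osc (Im \o g) s t q) +i*
  (osc (Re \o g) s t q + osc (Im \o g) s t 0).
Proof.
move=> [g1 g2] s t q.
have E w : expC (W w * z - (W w * z)^*) = wave X Y s t 0 w +i* wave X Y s t q w.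
  have -> : W w * z - (W w * z)^* = 0 +i* (s * X w + t * Y w).
    by rewrite /s /t; case: z {s t} => a b; apply: complex_ext => /=; ring.
  apply: complex_ext; rewrite ?Re_expC ?Im_expC /= expR0 mul1r /wave ?addr0//.
  by rewrite /q cosBpihalf.
apply: complex_ext => /=.
  rewrite -RintegralB//; [|exact: Rintegrable_wave|exact: Rintegrable_wave].
  by apply: eq_Rintegral => w _; rewrite E ReM.
rewrite -RintegralD//; [|exact: Rintegrable_wave|exact: Rintegrable_wave].
by apply: eq_Rintegral => w _; rewrite E ImM.
Qed.

Lemma Cintegral_osc_decay (g : T -> C) (e : R) :
  (forall h, Rintegrable mu h -> wave_decay mu X Y h) ->
  Cintegrable mu g -> 0 < e -> exists r : R, forall z, r <= absC z ->
    absC (Cintegral mu (fun w => g w * expC (W w * z - (W w * z)^*))) <= e.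
Proof.
move=> RL gi e0; have e4 : 0 < e / 4 by rewrite divr_gt0.
have [g1 g2] := gi.
have [_ /(_ _ e4)[r1 h1]] := RL _ g1; have [_ /(_ _ e4)[r2 h2]] := RL _ g2.
exists (Num.max r1 r2) => z; rewrite ge_max => /andP[z1 z2].
have zst : absC z <= `|2 * Im z| + `|2 * Re z|.
  rewrite !normrM (ger0_norm (ler0n R 2)); have := absC_le z.
  by have := normr_ge0 (Re z); have := normr_ge0 (Im z); lra.
rewrite Cintegral_osc//; apply: le_trans (absC_le _) _ => /=.
set s := 2 * Im z in zst *; set t := 2 * Re z in zst *; set q := - (pi / 2).
have a1 c := h1 s t c (le_trans z1 zst); have a2 c := h2 s t c (le_trans z2 zst).
have := ler_normB (osc (Re \o g) s t 0) (osc (Im \o g) s t q).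
have := ler_normD (osc (Re \o g) s t q) (osc (Im \o g) s t 0).
have := a1 0; have := a1 q; have := a2 0; have := a2 q.
rewrite /=; lra.
Qed.

(** The equation at [z] gives only two relations between four real integrals. At [- z] the cosines
    are unchanged and the sines change sign, which separates them; other phases follow by the
    addition formula. *)
Lemma Cintegral_osc_null (g : T -> C) : Cintegrable mu g ->
  (forall z, Cintegral mu (fun w => g w * expC (W w * z - (W w * z)^*)) = 0) ->
  wave_null mu X Y (Re \o g) /\ wave_null mu X Y (Im \o g).
Proof.
move=> gi g0; have [g1 g2] := gi; set q := - (pi / 2) : R.
have waveN s t w : (wave X Y (- s) (- t) 0 w = wave X Y s t 0 w) *
    (wave X Y (- s) (- t) q w = - wave X Y s t q w).
  rewrite /wave !addr0 /q !cosBpihalf !mulNr -opprD cosN sinN.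
  by split.
have oscN (h : T -> R) s t : Rintegrable mu h ->
    (osc h (- s) (- t) 0 = osc h s t 0) * (osc h (- s) (- t) q = - osc h s t q).
  move=> hi; split; first by apply: eq_Rintegral => w _; rewrite waveN.
  rewrite -[RHS]mulN1r -RintegralZl//; last exact: Rintegrable_wave.
  by apply: eq_Rintegral => w _; rewrite waveN; ring.
have z0 s t : [/\ osc (Re \o g) s t 0 = 0, osc (Re \o g) s t q = 0,
    osc (Im \o g) s t 0 = 0 & osc (Im \o g) s t q = 0].
  have := g0 ((t / 2) +i* (s / 2)); rewrite Cintegral_osc//= -/q.
  rewrite ![2 * (_ / 2)]mulrC !divfK ?pnatr_eq0// => -[e1 e2].
  have := g0 ((- t / 2) +i* (- s / 2)); rewrite Cintegral_osc//= -/q.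
  rewrite ![2 * (_ / 2)]mulrC !divfK ?pnatr_eq0// !oscN// => -[e3 e4].
  by split; lra.
have waveE (h : T -> R) s t c : Rintegrable mu h ->
    osc h s t c = cos c * osc h s t 0 - sin c * osc h s t q.
  move=> hi; have iw := fun c => Rintegrable_wave mX mY s t c hi.
  rewrite -!RintegralZl//; [|exact: iw|exact: iw].
  rewrite -RintegralB//; [|exact/RintegrableZ/iw|exact/RintegrableZ/iw].
  apply: eq_Rintegral => w _; rewrite /wave cosD addr0 /q cosBpihalf; ring.
by split; split => // s t c; rewrite waveE//; have [z1 z2 z3 z4] := z0 s t;
  rewrite ?z1 ?z2 ?z3 ?z4 !mulr0 subr0.
Qed.

Definition laplace (G : T -> C) (al be : C) : C :=
  Cintegral mu (fun w => G w * expC (W w * al + (W w)^* * be)).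

Theorem laplace_finite_rank_eq0 (G : T -> C) N (a b : 'I_N -> C -> C) :
  (forall h, Rintegrable mu h -> wave_decay mu X Y h) -> exp_moments G W ->
  (forall al be, laplace G al be = \sum_j a j al * b j be) ->
  forall al be, laplace G al be = 0.
Proof.
move=> RL GW HE al0 be0; apply/eqP; apply/negPn/negP => H0.
have [n [x [y [uM HF]]]] := maximal_minor HE H0.
set M := gram _ x y in uM HF.
(* In [K z] the two shifts add the purely imaginary [W w * z - (W w * z)^*] to the exponents, so its
   entries are Fourier transforms, while [A z] is holomorphic and [B z] antiholomorphic in [z]. *)
pose xz z i := x i + z; pose yz z i := y i - z^*.
pose A z := gram (laplace G) (xz z) y; pose B z := gram (laplace G) x (yz z).
pose K z := gram (laplace G) (xz z) (yz z).
have M0 : \det M != 0 by move: uM; rewrite unitmxE unitfE.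
have detK z : \det (K z) * \det M = \det (A z) * \det (B z).
  by rewrite /K HF !det_mulmx det_inv mulrAC mulfVK.
have aA : poly_approx (fun z => \det (A z)).
  apply: poly_approx_det => i j.
  have := laplace_approx (exp_moments_exp (x i) (y j) GW).
  congr poly_approx; apply/funext => z; rewrite mxE; apply: Cintegral_ext => w.
  by rewrite -mulrA -expCD /xz; congr (_ * expC _); ring.
have aB : poly_approx (fun z => (\det (B z))^*).
  under eq_fun do rewrite -det_map_mx.
  apply: poly_approx_det => i j.
  (* Conjugation turns the displacement in the exponent into [- W w * z]: the entry is a Laplace
     transform of the conjugate weight with respect to [- W]. *)
  have GW' := exp_moments_exp (x i) (y j) GW.
  have := laplace_approx (exp_momentsN (exp_momentsJ GW')).
  congr poly_approx; apply/funext => z.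
  transitivity ((laplace G (x i) (yz z j))^*); last by rewrite !mxE.
  rewrite /laplace CintegralJ.
    apply: Cintegral_ext => w; rewrite (conjcM (G w)) (conjcM (G w)) !conj_expC.
    rewrite -mulrA -expCD /yz; congr (_ * expC _).
    rewrite !conjcD !conjcM conjcB !conjcK; ring.
  exact: exp_moments_int (exp_moments_exp (x i) (yz z j) GW).
have M1 : 0 < absC (\det M).
  rewrite lt_neqAle absC_ge0 andbT eq_sym; apply: contra M0 => /eqP.
  by move/Normc.eq0_normc ->.
(* The bound 1 is the one [absC_det_le] requires; the other makes [\det (K z)] at most half of
   [\det M] in modulus. *)
pose e : R := Num.min 1 (absC (\det M) / (2 * (n.+1)`!%:R)).
have fact0 : 0 < (n.+1)`!%:R :> R by rewrite ltr0n fact_gt0.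
have e0 : 0 < e by rewrite lt_min ltr01 divr_gt0// mulr_gt0.
have [r hr] : exists r : R, forall z, r <= absC z -> forall i j, absC (K z i j) <= e.
  have ex (ij : 'I_n.+1 * 'I_n.+1) : exists r : R, forall z, r <= absC z ->
      absC (K z ij.1 ij.2) <= e.
    case: ij => i j /=.
    have gi := exp_moments_int (exp_moments_exp (x i) (y j) GW).
    have [r hr] := Cintegral_osc_decay RL gi e0; exists r => z /hr.
    congr (absC _ <= _); rewrite mxE; apply: Cintegral_ext => w.
    rewrite -mulrA -expCD /xz /yz conjcM; congr (_ * expC _); ring.
  have [r hr] := choice ex.
  exists (\sum_ij `|r ij|) => z zr i j; apply: (hr (i, j)); apply: le_trans zr.
  rewrite (bigD1 (i, j))//= (le_trans (ler_norm _))// lerDl.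
  by apply: sumr_ge0.
have A0 : A 0 = M by apply/matrixP => i j; rewrite !mxE /xz addr0.
have B0 : B 0 = M by apply/matrixP => i j; rewrite !mxE /yz conjc0 subr0.
(* On the circle of radius [|r|] the product has modulus [|\det (K z)| |\det M|], at most half of
   its modulus [|\det M| ^+ 2] at 0. *)
have := @max_modulus _ _ `|r| (absC (\det M) / 2 * absC (\det M)) (normr_ge0 r)
  (poly_approxM aA aB).
rewrite absCM absCJ A0 B0 => /(_ _)/wrap[].
  move=> z zr; rewrite absCM absCJ -absCM -detK absCM ler_wpM2r ?absC_ge0//.
  have rz : r <= absC z by rewrite zr ler_norm.
  have e1 : e <= 1 by rewrite ge_min lexx.
  apply: le_trans (absC_det_le e1 (hr z rz)) _.
  have e2 : e <= absC (\det M) / (2 * (n.+1)`!%:R) by rewrite ge_min lexx orbT.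
  have -> : absC (\det M) / 2 = (n.+1)`!%:R * (absC (\det M) / (2 * (n.+1)`!%:R)).
    by field; rewrite gt_eqF.
  by rewrite ler_wpM2l// ltW.
rewrite ler_pM2r//; lra.
Qed.

Theorem laplace_finite_rank_ae (G : T -> C) N (a b : 'I_N -> C -> C) :
  borel_mod0 mu X Y ->
  (forall h, Rintegrable mu h -> wave_decay mu X Y h) -> exp_moments G W ->
  (forall al be, laplace G al be = \sum_j a j al * b j be) ->
  {ae mu, forall w, G w = 0}.
Proof.
move=> bor RL GW HE.
have H0 := laplace_finite_rank_eq0 RL GW HE.
have [|n1 n2] := Cintegral_osc_null (exp_moments_int GW).
  move=> z; rewrite -[RHS](H0 z (- z^*)); apply: Cintegral_ext => w.
  by rewrite conjcM; congr (_ * expC _); ring.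
have := wave_null_ae mX mY bor n1; have := wave_null_ae mX mY bor n2.
by apply: filterS2 => w e2 e1; exact: complex_ext.
Qed.

End laplace.

(** * Lebesgue measure on the plane *)

Section completion.
Context d (T : measurableType d) (R : realType) (m : {measure set T -> \bar R}).
Local Notation U := (caratheodory_type ((m : set T -> \bar R)^*)%mu).
Local Notation nu := (@completed_measure_extension _ _ _ m).

Lemma completion_measurable (A : set T) : measurable A -> measurable (A : set U).
Proof. exact: caratheodory_measurable_mu_ext. Qed.

Lemma completionE (A : set T) : measurable A -> nu A = m A.
Proof. exact: measurable_mu_extE. Qed.

(** [nu A] is an infimum over countable measurable covers, so some cover has excess at most
    [1 / n.+1]; the intersection over [n] is the hull. Finiteness lets the excess be computed as a
    difference. *)
Lemma completion_hull (A : set U) : measurable A -> (nu A < +oo)%E ->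
  exists B : set T, [/\ measurable B, A `<=` B & nu.-negligible (B `\` A)].
Proof.
move=> mA Afin.
have Anum : nu A \is a fin_num by rewrite ge0_fin_numE.
have hull (n : nat) : exists B : set T,
    [/\ measurable B, A `<=` B & (nu (B `\` A) <= (n.+1%:R^-1)%:E)%E].
  have n0 : 0 < n.+1%:R^-1 :> R by rewrite invr_gt0.
  have [x [F [mF AF] <-] Fx] := lb_ereal_inf_adherent n0 Anum.
  pose B : set T := \bigcup_k F k.
  have mB : measurable B by exact: bigcup_measurable.
  have mB' : measurable (B : set U) by exact: completion_measurable.
  have leB : (nu B <= nu A + (n.+1%:R^-1)%:E)%E.
    rewrite (le_trans _ (ltW Fx))// completionE//.
    exact: measure_sigma_subadditive.
  exists B; split => //.
  have -> : nu (B `\` A) = (nu B - nu A)%E.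
    rewrite measureD//; last by rewrite (le_lt_trans leB)// lte_add_pinfty ?ltry.
    by congr (_ - nu _)%E; apply: setIidr.
  by rewrite leeBlDl.
have [B hB] := choice hull.
exists (\bigcap_n B n); split.
- by apply: bigcapT_measurable => n; have [] := hB n.
- by move=> w Aw n _; have [_ AB _] := hB n; exact: AB.
have mBA n : measurable ((B n : set U) `\` A).
  by apply: measurableD => //; apply: completion_measurable; have [] := hB n.
exists (\bigcap_n ((B n : set U) `\` A)); split.
- exact: bigcapT_measurable.
- apply/eqP; rewrite eq_le measure_ge0 andbT; apply/lee_addgt0Pr => e e0.
  rewrite add0e.
  have [n ne] : exists n : nat, n.+1%:R^-1 <= e.
    exists (Num.bound e^-1); rewrite -[e]invrK lef_pV2 ?posrE ?invr_gt0//.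
    rewrite ltW// (lt_trans (archi_boundP _)) ?invr_ge0 ?ltW// invrK ltr_nat//.
  have [_ _ le1] := hB n.
  apply: le_trans (le_trans le1 _); last by rewrite lee_fin.
  apply: le_measure; rewrite ?inE//; first exact: bigcapT_measurable.
  exact: bigcap_inf.
- by move=> w [Bw nAw] n _; split => //; exact: Bw.
Qed.

(** [completion_hull] asks for finite measure, hence the cut along [K n]. The union of the hulls
    contains [A], so only the excess has to be negligible. *)
Lemma completion_mod0 (K : nat -> set T) (A : set U) :
  (forall n, measurable (K n)) -> (forall n, (m (K n) < +oo)%E) ->
  (\bigcup_n K n = setT) -> measurable A ->
  exists2 B : set T, measurable B & nu.-negligible ((A `\` B) `|` (B `\` A)).
Proof.
move=> mK Kfin Kcov mA.
have mKA n : measurable (A `&` (K n : set U)).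
  by apply: measurableI => //; exact: completion_measurable.
have hull n : exists B : set T, [/\ measurable B, A `&` K n `<=` B &
    nu.-negligible (B `\` (A `&` K n))].
  apply: completion_hull => //; apply: le_lt_trans (Kfin n).
  rewrite -completionE//; apply: le_measure; rewrite ?inE//.
  exact: completion_measurable.
have [B hB] := choice hull.
exists (\bigcup_n B n).
  by apply: bigcup_measurable => n _; have [] := hB n.
have neg : nu.-negligible (\bigcup_n ((B n : set U) `\` (A `&` (K n : set U)))).
  by apply: negligible_bigcup => n; have [] := hB n.
apply: negligibleS neg => w [[Aw nB]|[[n _ Bw] nAw]].
  have : (\bigcup_n K n) w by rewrite Kcov.
  move=> [n _ Kw]; exfalso; apply: nB; exists n => //.
  by have [_ AB _] := hB n; exact: AB.
by exists n => //; split => // -[].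
Qed.

End completion.

(** * Fourier decay and exponential moments on the completed plane *)

Section plane.
Context {R : realType}.
Local Notation C := R[i].
Local Notation absC := (@Normc.normc R).
Local Notation RR := (measurableTypeR R * measurableTypeR R)%type.
Local Notation leb := (@lebesgue_measure R).
Local Notation leb2 := (leb \x leb)%E.
Local Notation P := (lebesgue_plane (R := R)).
Local Notation mu := (@lebesgue_measure2 R).

Definition px (p : P) : R := p.1.
Definition py (p : P) : R := p.2.

(** The source carries the Lebesgue sigma-algebra, the target the Borel one. Pushing [mu] forward
    along this identity gives the product measure, and with it Fubini. *)
Definition plane_id (p : P) : RR := p.

Lemma measurable_plane_id : measurable_fun setT plane_id.
Proof.
by move=> _ B mB; rewrite setTI; exact: completion_measurable.
Qed.

Lemma measurable_px : measurable_fun setT px.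
Proof. exact: (measurableT_comp measurable_fst measurable_plane_id). Qed.

Lemma measurable_py : measurable_fun setT py.
Proof. exact: (measurableT_comp measurable_snd measurable_plane_id). Qed.

Definition box (n : nat) : set RR :=
  `[- (n%:R : R), n%:R]%classic `*` `[- (n%:R : R), n%:R]%classic.

Lemma measurable_box n : measurable (box n).
Proof. by apply: measurableX; exact: measurable_itv. Qed.

Lemma near_box (p : RR) : \forall n \near \oo, box n p.
Proof.
have [m hm] : exists m : nat, `|p.1| + `|p.2| <= m%:R.
  by exists (Num.bound (`|p.1| + `|p.2|)); rewrite ltW// archi_boundP// addr_ge0.
exists m => // n /= mn; have mn' : m%:R <= n%:R :> R by rewrite ler_nat.
have h1 := normr_ge0 p.1; have h2 := normr_ge0 p.2.
split; rewrite /= in_itv/= -ler_norml; lra.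
Qed.

Lemma leb_itv_fin (a b : R) : (leb [set` `[a, b]%R] < +oo)%E.
Proof.
by rewrite lebesgue_measure_itv/=; case: ifP => _; rewrite ?ltry// -EFinD ltry.
Qed.

Lemma box_fin n : (leb2 (box n) < +oo)%E.
Proof.
rewrite product_measure1E; [|exact: measurable_itv|exact: measurable_itv].
have h := leb_itv_fin (- n%:R) n%:R.
by apply: lte_mul_pinfty => //; rewrite ge0_fin_numE.
Qed.

Lemma plane_borel_mod0 : borel_mod0 mu px py.
Proof.
move=> A mA.
have [|B mB AB] := @completion_mod0 _ _ _ leb2 box A measurable_box box_fin _ mA.
  apply/seteqP; split => // p _; have [n _ /(_ n (leqnn n))] := near_box p.
  by exists n.
exists B => //; apply: negligibleS AB => -[x y] /=.
by rewrite /px /py /=.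
Qed.

Lemma integral_plane (f : RR -> R) : measurable_fun setT f ->
  leb2.-integrable setT (EFin \o f) ->
  Rintegrable mu (f \o plane_id) /\
  (\int[mu]_p (f p)%:E = \int[leb2]_p (f p)%:E)%E.
Proof.
move=> mf fi.
have push A : measurable A -> pushforward mu plane_id A = leb2 A.
  by move=> mA; exact: completionE.
have mf' : measurable_fun setT (EFin \o f) by exact/measurable_EFinP.
have fi' : Rintegrable mu (f \o plane_id).
  apply/integrableP; split.
    apply/measurable_EFinP; exact: measurableT_comp measurable_plane_id.
  have /integrableP[_] := fi; congr (_ < _)%E.
  have mabs : measurable_fun setT (abse \o (EFin \o f)).
    by apply: measurableT_comp => //; exact: measurable_abse.
  have := @ge0_integral_pushforward _ _ _ _ _ _ measurable_plane_id mu setT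
    (abse \o (EFin \o f)) measurableT mabs (fun _ _ => abse_ge0 _).
  rewrite preimage_setT => <-.
  symmetry; apply: eq_measure_integral => [|mi A mA _].
    exact: measurable_plane_id.
  exact: push.
split => //.
have := @integral_pushforward _ _ _ _ _ _ measurable_plane_id mu setT
  (EFin \o f) mf'.
rewrite preimage_setT => /(_ fi' measurableT) /= <-.
apply: eq_measure_integral => [|mi A mA _]; first exact: measurable_plane_id.
exact: push.
Qed.

(** The primitive [s^-1 * sin (s * x + b)] is bounded by [1 / |s|], whatever the length of the
    interval. *)
Lemma norm_integral_cos_le (s b : R) n : s != 0 ->
  `|\int[leb]_(x in `[- n.+1%:R, n.+1%:R]) cos (s * x + b)| <= 2 / `|s|.
Proof.
move=> s0; pose F x := s^-1 * sin (s * x + b).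
have dg (x : R) : is_derive x 1 (fun x : R => s * x + b) s.
  have := is_deriveD (is_deriveZ s (is_derive_id x 1)) (is_derive_cst b x 1).
  by rewrite addr0 [_ *: _]mulr1.
have dF (x : R) : is_derive x 1 F (cos (s * x + b)).
  have hc : is_derive x 1 (@sin R \o (fun x => s * x + b)) (cos (s * x + b) * s).
    exact: is_derive1_comp.
  have := is_deriveZ s^-1 hc.
  by rewrite [_ *: _]mulrCA mulVf// mulr1.
have cont (f : R -> R) (df : R -> R) :
    (forall x : R, is_derive x 1 f (df x)) -> continuous f.
  move=> df' x; apply: differentiable_continuous; apply/derivable1_diffP.
  have := df' x => ?; exact: ex_derive.
rewrite /Rintegral (@continuous_FTC2 _ _ F).
- rewrite -EFinB /= -mulrBr normrM normfV mulrC ler_wpM2r ?invr_ge0//.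
  rewrite (le_trans (ler_normB _ _))//.
  have h (y : R) : `|sin y| <= 1 by rewrite ler_norml sin_geN1 sin_le1.
  by rewrite (_ : 2 = 1 + 1) ?lerD//; ring.
- by rewrite -subr_gt0 opprK addr_gt0.
- apply: continuous_subspaceT => x.
  apply: (continuous_comp (f := fun x : R => s * x + b)); first exact: cont dg x.
  exact: continuous_cos.
- split.
  + by move=> x _; have := dF x => ?; exact: ex_derive.
  + by apply: cvg_at_right_filter; exact: (cont _ _ dF).
  + by apply: cvg_at_left_filter; exact: (cont _ _ dF).
- by move=> x _; rewrite derive1E; have := dF x => ?; exact: derive_val.
Qed.

Local Notation I n := (`[- n.+1%:R, n.+1%:R]%classic : set R).

(** [j] stands for the indicator in the other coordinate, constant during the inner integration. *)
Lemma abse_integral_strip_le (s b j : R) n : s != 0 -> 0 <= j ->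
  (`|\int[leb]_x (\1_(I n) x * j * cos (s * x + b))%:E| <= (j * (2 / `|s|))%:E)%E.
Proof.
move=> s0 j0.
have ic : leb.-integrable (I n) (EFin \o (fun x => cos (s * x + b))).
  apply: measurable_bounded_integrable; first exact: measurable_itv.
  - exact: leb_itv_fin.
  - apply: measurableT_comp.
      by apply: continuous_measurable_fun => x; exact: continuous_cos.
    by apply: measurable_funD => //; exact: measurable_funM.
  - exists 1; split => // M M1 x _ /=; apply: le_trans (ltW M1).
    by rewrite ler_norml cos_geN1 cos_le1.
have -> : (\int[leb]_x (\1_(I n) x * j * cos (s * x + b))%:E =
   \int[leb]_(x in I n) (j%:E * (cos (s * x + b))%:E))%E.
  rewrite [RHS]integral_mkcond; apply: eq_integral => x _.
  by rewrite /patch indicE; case: (_ \in _); rewrite ?mul1r ?mul0r ?EFinM.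
rewrite integralZl//.
have fin : (\int[leb]_(x in I n) (cos (s * x + b))%:E)%E \is a fin_num.
  exact: integrable_fin_num ic.
rewrite -(fineK fin).
rewrite -EFinM lee_fin normrM ger0_norm// ler_wpM2l//.
exact: norm_integral_cos_le.
Qed.

Lemma abse_integral_interval_le (G : R -> \bar R) (K : R) n :
  measurable_fun setT G -> 0 <= K -> (forall y, `|G y| <= (\1_(I n) y * K)%:E)%E ->
  (`|\int[leb]_y G y| <= (2 * n.+1%:R * K)%:E)%E.
Proof.
move=> mG K0 GK; apply: le_trans (le_abse_integral leb measurableT mG) _.
apply: (@le_trans _ _ (\int[leb]_y (\1_(I n) y * K)%:E)%E).
  apply: ge0_le_integral => //.
  - by apply: measurableT_comp => //; exact: measurable_abse.
  - by apply/measurable_EFinP; apply: measurable_funM => //; exact: measurable_indic.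
under eq_integral do rewrite EFinM.
rewrite ge0_integralZr//=; last first.
  by apply/measurable_EFinP; exact: measurable_indic.
rewrite integral_indic//= setIT lebesgue_measure_itv/=.
have lt : - n.+1%:R < n.+1%:R :> R by rewrite -subr_gt0 opprK addr_gt0.
rewrite lte_fin lt -EFinD -EFinM lee_fin opprK.
by rewrite -mulr2n -[X in X * K <= _]mulr_natl.
Qed.

Definition boxwave n (s t c : R) (p : RR) : R :=
  \1_(box n.+1) p * cos (s * p.1 + t * p.2 + c).

Lemma measurable_boxwave n s t c : measurable_fun setT (boxwave n s t c).
Proof.
apply: measurable_funM; first by apply: measurable_indic; exact: measurable_box.
apply: measurableT_comp.
  by apply: continuous_measurable_fun => x; exact: continuous_cos.
apply: measurable_funD => //; apply: measurable_funD; apply: measurable_funM => //.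
Qed.

Lemma boxwaveE n s t c x y : boxwave n s t c (x, y) =
  \1_(I n) x * \1_(I n) y * cos (s * x + t * y + c).
Proof. by rewrite /boxwave /= !indicE /box in_setX /= -natrM mulnb. Qed.

Lemma integrable_boxwave n s t c :
  leb2.-integrable setT (EFin \o boxwave n s t c).
Proof.
apply: (@le_integrable _ _ _ leb2 setT measurableT _ (EFin \o \1_(box n.+1))).
- by apply/measurable_EFinP; exact: measurable_boxwave.
- move=> p _; rewrite /= lee_fin normrM ler_piMr// ler_norml.
  by rewrite cos_geN1 cos_le1.
apply/integrableP; split.
  by apply/measurable_EFinP; apply: measurable_indic; exact: measurable_box.
under eq_integral do rewrite /= ger0_norm//.
rewrite integral_indic//; last exact: measurable_box.
by rewrite setIT box_fin.
Qed.

(** Integrating first along the coordinate with nonzero frequency gains [2 / |s|] or [2 / |t|]; the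
    other contributes the side length [2 * n.+1]. *)
Lemma norm_integral_box_le (s t c : R) n :
  (s != 0 -> `|\int[mu]_p (\1_(box n.+1) p * wave px py s t c p)| <=
    4 * n.+1%:R / `|s|) /\
  (t != 0 -> `|\int[mu]_p (\1_(box n.+1) p * wave px py s t c p)| <=
    4 * n.+1%:R / `|t|).
Proof.
have ib := integrable_boxwave n s t c.
have [_ ibE] := integral_plane (measurable_boxwave n s t c) ib.
have -> : \int[mu]_p (\1_(box n.+1) p * wave px py s t c p) =
   fine (\int[leb2]_p (boxwave n s t c p)%:E)%E by rewrite -ibE.
have fin := integrable_fin_num measurableT ib.
split => [s0|t0]; rewrite -lee_fin -abse_EFin fineK//.
- rewrite -(integral21_prod_meas1 ib).
  apply: (@le_trans _ _ (2 * n.+1%:R * (2 / `|s|))%:E); last first.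
    by rewrite lee_fin le_eqVlt; apply/predU1P; left; field; rewrite normr_eq0.
  apply: abse_integral_interval_le; first exact: (measurable_fubini_G ib).
  + by rewrite divr_ge0.
  move=> y; rewrite /fubini_G.
  under eq_integral do rewrite /= boxwaveE -addrA.
  by apply: abse_integral_strip_le.
- rewrite -(integral12_prod_meas1 ib).
  apply: (@le_trans _ _ (2 * n.+1%:R * (2 / `|t|))%:E); last first.
    by rewrite lee_fin le_eqVlt; apply/predU1P; left; field; rewrite normr_eq0.
  apply: abse_integral_interval_le; first exact: (measurable_fubini_F ib).
  + by rewrite divr_ge0.
  move=> x; rewrite /fubini_F.
  under eq_integral do
    rewrite /= boxwaveE [_ * \1_(I n) _]mulrC [s * x + _]addrC -addrA.
  by apply: abse_integral_strip_le.
Qed.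

(** This will dominate the moments far from the origin. Being a product rather than radial, it
    reduces by Tonelli to two integrals on the line, each equal to [pi]. *)
Lemma integrable_decay :
  Rintegrable mu (fun p => (1 + px p ^+ 2)^-1 * (1 + py p ^+ 2)^-1).
Proof.
pose f (p : RR) : R := (1 + p.1 ^+ 2)^-1 * (1 + p.2 ^+ 2)^-1.
have c1 : measurable_fun setT (fun x : R => (1 + x ^+ 2)^-1).
  apply: continuous_measurable_fun => x; exact: continuous_oneDsqrV.
have mf : measurable_fun setT f.
  apply: measurable_funM.
    exact: (measurableT_comp c1 measurable_fst).
  exact: (measurableT_comp c1 measurable_snd).
have [|h _] := @integral_plane f mf; last exact: h.
apply/integrable12ltyP; first exact/measurable_EFinP.
have int1 : (\int[leb]_x ((1 + x ^+ 2)^-1)%:E = pi%:E)%E.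
  rewrite (ge0_symfun_integralT (f := fun x : R => (1 + x ^+ 2)^-1)).
  - rewrite -set_itvcy integral0y_oneDsqr -EFinM; congr EFin.
    by rewrite mulrC divfK.
  - by move=> x; rewrite invr_ge0 addr_ge0 ?sqr_ge0.
  - by move=> x; exact: continuous_oneDsqrV.
  - by move=> x /=; rewrite sqrrN.
have inner (x : R) :
    (\int[leb]_y `|(EFin \o f) (x, y)| = pi%:E * ((1 + x ^+ 2)^-1)%:E)%E.
  transitivity (\int[leb]_y (((1 + x ^+ 2)^-1)%:E * ((1 + y ^+ 2)^-1)%:E))%E.
    apply: eq_integral => y _; rewrite /= ger0_norm -?EFinM//.
    by rewrite mulr_ge0 ?invr_ge0 ?addr_ge0 ?sqr_ge0.
  rewrite ge0_integralZl//=.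
  - by rewrite int1 muleC.
  - exact/measurable_EFinP.
  - by move=> y _; rewrite lee_fin invr_ge0 addr_ge0 ?sqr_ge0.
  - by rewrite lee_fin invr_ge0 addr_ge0 ?sqr_ge0.
under eq_integral do rewrite inner.
rewrite ge0_integralZl//=.
- by rewrite int1 -EFinM ltry.
- exact/measurable_EFinP.
- by move=> y _; rewrite lee_fin invr_ge0 addr_ge0 ?sqr_ge0.
- by rewrite lee_fin pi_ge0.
Qed.

Lemma box_decay n : wave_decay mu px py (\1_(box n.+1)).
Proof.
split.
  have [+ _] := integral_plane (measurable_boxwave n 0 0 0)
    (integrable_boxwave n 0 0 0).
  congr Rintegrable; apply/funext => p.
  by rewrite /= /boxwave !mul0r !addr0 cos0 mulr1.
(* If [|s| + |t|] reaches this radius, one of the two reaches half of it, where the box estimate is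
   at most [e]. *)
move=> e e0; exists (8 * n.+1%:R / e) => s t c st.
have r0 : 0 < 8 * n.+1%:R / e :> R by rewrite divr_gt0// mulr_gt0.
have [hs ht] := norm_integral_box_le s t c n.
have bound (u : R) : 4 * n.+1%:R / e <= `|u| -> 4 * n.+1%:R / `|u| <= e.
  have r1 : 0 < 4 * n.+1%:R / e :> R by rewrite divr_gt0// mulr_gt0.
  move=> h; have u0 : 0 < `|u| := lt_le_trans r1 h.
  by move: h; rewrite !ler_pdivrMr// [e * _]mulrC.
have hE : 8 * n.+1%:R / e = 4 * n.+1%:R / e + 4 * n.+1%:R / e.
  by rewrite -!mulrDl; congr (_ * _ / _); ring.
have r1 : 0 < 4 * n.+1%:R / e :> R by rewrite divr_gt0// mulr_gt0.
have [sB|sB] := leP (4 * n.+1%:R / e) `|s|.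
  by apply: le_trans (hs _) (bound _ sB); rewrite -normr_gt0 (lt_le_trans r1).
have tB : 4 * n.+1%:R / e <= `|t| by move: st; rewrite hE; lra.
by apply: le_trans (ht _) (bound _ tB); rewrite -normr_gt0 (lt_le_trans r1).
Qed.

Lemma plane_riemann_lebesgue (h : P -> R) : Rintegrable mu h ->
  wave_decay mu px py h.
Proof.
apply: (@riemann_lebesgue _ _ _ mu px py measurable_px measurable_py
  (fun n => box n.+1)).
- exact: plane_borel_mod0.
- by move=> n; apply: completion_measurable; exact: measurable_box.
- exact: box_decay.
- move=> p; have [N _ hN] := near_box p; exists N => // n /= Nn.
  by apply: hN; exact: leqW.
Qed.

Lemma oneDsqr_le_expR (x u : R) : `|x| <= u -> 1 + x ^+ 2 <= expR (2 * u).
Proof.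
move=> xu; rewrite (_ : 2 * u = u + u); last by ring.
rewrite expRD -real_normK ?num_real//.
have h : 1 + `|x| <= expR u.
  by apply: le_trans (expR_ge1Dx _); rewrite lerD2l.
have := ler_pM (addr_ge0 ler01 (normr_ge0 x)) (addr_ge0 ler01 (normr_ge0 x)) h h.
by apply: le_trans; have := normr_ge0 x; rewrite expr2; nra.
Qed.

Local Notation weighted F := (fun p : P => F (C_of_R2 p) * (omega (C_of_R2 p))%:C).

Lemma plane_exp_moments (F : C -> C) : D1minus F ->
  exp_moments mu (weighted F) (fun p => px p +i* py p).
Proof.
move=> [[mF Floc] Fgrowth].
have mW : Cmeasurable (fun p : P => px p +i* py p).
  by split; [exact: measurable_px|exact: measurable_py].
have mabs : measurable_fun setT (fun p : P => absC (px p +i* py p)).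
  exact: measurable_absC.
have mG : Cmeasurable (weighted F).
  have mO : measurable_fun setT (fun p : P => omega (C_of_R2 p)).
    apply: measurable_funM; first exact: measurable_cst.
    apply: measurableT_comp; first exact: measurable_expR.
    by apply: measurable_funN; exact: measurable_funX.
  have mOC : Cmeasurable (fun p : P => (omega (C_of_R2 p))%:C).
    by split; [exact: mO|exact: measurable_cst].
  exact: CmeasurableM mF mOC.
split => // a.
(* Of the rate [a + 4], [a] cancels the weight of the moment and 4 leaves [expR (- (2 * |z|))] for
   each coordinate, to be bounded by [oneDsqr_le_expR]. *)
have [M [r FM]] := Fgrowth (a + 4).
pose K : set RR := `[- `|r|, `|r|]%classic `*` `[- `|r|, `|r|]%classic.
have mK : measurable (K : set P).
  by apply: completion_measurable; apply: measurableX; exact: measurable_itv.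
have FK : Rintegrable mu (fun p => absC (F (C_of_R2 p)) * \1_K p).
  have mabsF : measurable_fun setT (fun p : P => absC (F (C_of_R2 p))).
    exact: measurable_absC.
  apply/integrableP; split.
    by apply/measurable_EFinP; apply: measurable_funM.
  have cK : compact (K : set (R * R)).
    by apply: compact_setX; exact: segment_compact.
  have := Floc _ cK; apply: le_lt_trans; rewrite [leRHS]integral_mkcond.
  rewrite le_eqVlt; apply/predU1P; left; apply: eq_integral => p _.
  rewrite /patch /= normrM indicE ger0_norm ?absC_ge0//.
  by case: (_ \in _); rewrite ?normr1 ?normr0 ?mulr1 ?mulr0.
have pi0 : 0 <= pi^-1 :> R by rewrite invr_ge0 pi_ge0.
(* The first term dominates where the growth bound holds; the second takes over for [|z| < r], a
   region inside the compact square [K], through local integrability. *)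
pose B (p : P) : R := (`|M| * pi^-1) * ((1 + px p ^+ 2)^-1 * (1 + py p ^+ 2)^-1) +
  (pi^-1 * expR (`|a| * `|r|)) * (absC (F (C_of_R2 p)) * \1_K p).
apply: (@Rintegrable_le _ _ _ _ _ B).
- apply: measurable_funM; first exact: measurable_absC.
  apply: measurableT_comp; first exact: measurable_expR.
  by apply: measurable_funM; [exact: measurable_cst|exact: mabs].
- move=> p; rewrite ger0_norm ?mulr_ge0 ?absC_ge0 ?expR_ge0//.
  rewrite -[px p +i* py p]/(C_of_R2 p); set z := C_of_R2 p.
  rewrite absCM absC_real /omega ger0_norm; last by rewrite mulr_ge0 ?expR_ge0.
  have zx : `|px p| <= absC z := absC_Re z.
  have zy : `|py p| <= absC z := absC_Im z.
  have z0 := absC_ge0 z; have F0 := absC_ge0 (F z).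
  have ex := oneDsqr_le_expR zx; have ey := oneDsqr_le_expR zy.
  have x0 : 0 < 1 + px p ^+ 2 by rewrite ltr_pwDl ?sqr_ge0.
  have y0 : 0 < 1 + py p ^+ 2 by rewrite ltr_pwDl ?sqr_ge0.
  have [rz|zr] := leP r (absC z).
    rewrite -[leLHS]addr0; apply: lerD; last first.
      by rewrite !mulr_ge0 ?expR_ge0 ?indicE.
    have hexp : expR (absC z ^+ 2 - (a + 4) * absC z) * (expR (- absC z ^+ 2) *
        expR (a * absC z)) = expR (- (2 * absC z)) * expR (- (2 * absC z)).
      by rewrite -!expRD; congr expR; ring.
    apply: (@le_trans _ _ (`|M| * pi^-1 *
        (expR (- (2 * absC z)) * expR (- (2 * absC z))))).
      rewrite -hexp.
      rewrite (_ : absC (F z) * (pi^-1 * expR (- absC z ^+ 2)) * expR (a * absC z) =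
        absC (F z) * (pi^-1 * (expR (- absC z ^+ 2) * expR (a * absC z))));
        last by ring.
      rewrite (_ : `|M| * pi^-1 * _ = `|M| * expR (absC z ^+ 2 - (a + 4) * absC z) *
        (pi^-1 * (expR (- absC z ^+ 2) * expR (a * absC z)))); last by ring.
      rewrite ler_wpM2r ?mulr_ge0 ?expR_ge0//.
      by rewrite (le_trans (FM z rz))// ler_wpM2r ?expR_ge0// ler_norm.
    rewrite ler_wpM2l ?mulr_ge0// expRN.
    by rewrite ler_pM ?invr_ge0 ?expR_ge0// lef_pV2 ?posrE ?expR_gt0.
  rewrite -[leLHS]add0r; apply: lerD.
    by apply: mulr_ge0; apply: mulr_ge0 => //; rewrite invr_ge0 ltW.
  have zr' : absC z <= `|r| by rewrite (le_trans (ltW zr))// ler_norm.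
  have -> : \1_K p = 1 :> R.
    rewrite indicE mem_set//; split; rewrite /= in_itv/= -ler_norml.
      exact: le_trans zx zr'.
    exact: le_trans zy zr'.
  rewrite mulr1 [leRHS]mulrC -mulrA ler_wpM2l// -mulrA ler_wpM2l//.
  apply: (@le_trans _ _ (1 * expR (a * absC z))).
    rewrite ler_wpM2r ?expR_ge0//.
    by rewrite -[leRHS]expR0 ler_expR oppr_le0 sqr_ge0.
  rewrite mul1r ler_expR (le_trans (ler_norm _))// normrM ler_wpM2l//.
  by rewrite ger0_norm.
- apply: RintegrableD; apply: RintegrableZ; first exact: integrable_decay.
  exact: FK.
Qed.

Lemma tform_laplace (F : C -> C) (al be : C) :
  tform F (kappa al^*) (kappa be) = laplace mu px py (weighted F) al be.
Proof.
apply: Cintegral_ext => p; rewrite /kappa -[px p +i* py p]/(C_of_R2 p).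
set z := C_of_R2 p.
have -> : Num.conj al^* = al :> C by rewrite -[LHS]/(al^*^*) conjcK.
have -> : Num.conj (expC (z * Num.conj be)) = expC (z^* * be) :> C.
  by rewrite -[LHS]/((expC (z * be^*))^*) conj_expC conjcM conjcK.
by rewrite expCD; ring.
Qed.

End plane.

Theorem theorem3p1 (R : realType) (F : R[i] -> R[i])
    (FD : D1minus F) (Frank : finite_rank_on_kernels F) :
  {ae @lebesgue_measure2 R, forall p, F (C_of_R2 p) = 0}.
Proof.
case: Frank => N [f [g [_ [_ HE]]]].
have : {ae @lebesgue_measure2 R, forall p,
    F (C_of_R2 p) * (omega (C_of_R2 p))%:C = 0}.
  apply: (@laplace_finite_rank_ae _ _ _ _ _ _ measurable_px measurable_py _ N
    (fun j al => pairing_rev (kappa al^*) (g j))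
    (fun j be => pairing (f j) (kappa be)) plane_borel_mod0
    (@plane_riemann_lebesgue R) (plane_exp_moments FD)).
  by move=> al be; rewrite -tform_laplace.
(* [omega] vanishes nowhere, so the same null set serves for [F]. *)
case=> A [mA A0 GA]; exists A; split => // p /= Fp; apply: GA => /= /eqP.
rewrite mulf_eq0 => /orP[/eqP//|/eqP/(congr1 (@complex.Re R)) /= /eqP].
by rewrite mulf_eq0 invr_eq0 gt_eqF ?pi_gt0//= gt_eqF ?expR_gt0.
Qed.
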